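(* Let $n\ge 10$ and $I\in\mathcal{I}_n$. Then the complex $\Delta(I)$ is a centrally symmetric combinatorial $3$-sphere on the vertex set $V_{n+1}$ that is cs-$2$-neighborly with respect to $V_{n+1}$.
   Context: Simplicial complexes are finite abstract simplicial complexes; $\overline{A}$ is the simplex of all subsets of a finite set $A$. $V_m=\{\pm1,\dots,\pm m\}$; $-\sigma=\{-v:v\in\sigma\}$, $-\Gamma=\{-\sigma:\sigma\in\Gamma\}$. The join is $\Gamma*\Gamma'=\{\sigma\cup\tau\}$, $\Gamma*v:=\Gamma*\overline{\{v\}}$; a path/cycle $(v_1,\dots,v_m)$ is the 1-dimensional complex with edges $\{v_j,v_{j+1}\}$. $\partial C^*_m$ is the complex of all subsets of $V_m$ with no pair $\{j,-j\}$. For pure $\Delta$ and pure full-dimensional subcomplex $\Gamma$, $\Delta\setminus\Gamma$ is generated by facets of $\Delta$ not in $\Gamma$; $\partial B$ is the boundary of a combinatorial ball $B$. Recursive definition: $\Delta^1_n=(1,\dots,n,-1,\dots,-n,1)$; $\Delta^d_{d+1}=\partial C^*_{d+1}$; $B^{d,j}_n=\emptyset$ for $j<0$; $B^{1,0}_n=\overline{\{-1,n\}}$; $B^{2k-1,k}_n=\Delta^{2k-1}_n\setminus B^{2k-1,k-1}_n$ ($k\ge1$, $n\ge 2k$); $B^{d,i}_n=(B^{d-1,i}_{n-1}*n)\cup((-B^{d-1,i-1}_{n-1})*(-n))$ ($d\ge2$, $n\ge d+1$, $i\le\lfloor d/2\rfloor$); $\Delta^d_{n+1}$ is obtained from $\Delta^d_n$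 by replacing $B=B^{d,\lceil d/2\rceil-1}_n$ with $\partial B*(n+1)$ and $-B$ with $\partial(-B)*(-n-1)$ (known to be well defined; $\Delta^3_n$ is a combinatorial 3-sphere on $V_n$). Let $\mathcal{I}_n$ be the collection of all sets $I=\{i_1<\dots<i_p\}\subseteq\{3,4,\dots,n-6\}$ ($p\ge0$) such that $i_2-i_1>1$ if $p\ge2$; set $i_{p+1}:=n-2$. Let $B(I)$ be the pure 3-dimensional complex whose facets are: $\{1,2,i,i+2\}$ for $3\le i\le n-2$; $\{1,2,n-1,n\}$; $\{1,-n+2,n-1,n\}$, $\{1,-n+2,-n+1,n\}$, $\{1,-n+2,-n+1,-n\}$; $\{-n+m+1,-n+m,n-1,n\}$ for $2\le m\le i_1$ (if $p=0$, for $2\le m\le n-2$); and for each $1\le j\le p$: $\{1,-n+i_j+2,n-i_j-1,n-i_j+1\}$ and $\{-n+m+1,-n+m,n-i_j-1,n-i_j+1\}$ for $i_j+2\le m\le i_{j+1}$. Let $\partial B(I)$ denote the complex generated by the 2-faces of $B(I)$ contained in exactly one facet of $B(I)$. Define $\Delta(I)$ as the complex obtained from $\Delta^3_n$ by replacing $B(I)$ with $\partial B(I)*(n+1)$ and $-B(I)$ with $\partial(-B(I))*(-n-1)$, i.e. its facets are the facets of $\Delta^3_n$ not in $B(I)\cup -B(I)$, together with $\tau\cup\{n+1\}$ and $-\tau\cup\{-n-1\}$ for facets $\tau$ of $\partial B(I)$. A complex is centrally symmetric if it is closed under $\sigma\mapsto -\sigma$; it is cs-$i$-neighborly w.r.t.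 $V_m$ if every subset of $V_m$ of size $\le i$ with no pair $\{v,-v\}$ is a face. *)

(* Defs.v *)
From mathcomp Require Import all_boot all_order all_algebra finmap.
From mathcomp Require Import reals.

Set Implicit Arguments.
Unset Strict Implicit.
Unset Printing Implicit Defensive.

Import Order.TTheory GRing.Theory Num.Theory.
Local Open Scope fset_scope.
Local Open Scope ring_scope.

(* A complex is the finite set of all its faces, the empty face included.
   [fset0] is the void complex; it is absorbing for the join, unlike
   [[fset fset0]], which is neutral. *)

Section Complexes.
Variable T : choiceType.
Implicit Types (s t A : {fset T}) (K L : {fset {fset T}}).

Definition is_complex K : Prop :=
  forall s t, s \in K -> t `<=` s -> t \in K.

Definition simplex A : {fset {fset T}} := fpowerset A.

Definition generated (F : seq {fset T}) : {fset {fset T}} :=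
  \bigcup_(s <- F) simplex s.

Definition vertices K : {fset T} := \bigcup_(s <- K) s.

Definition facets K : {fset {fset T}} :=
  [fset s in K | all (fun t => (s `<=` t) ==> (t == s)) K].

Definition join K L : {fset {fset T}} := [fset s `|` t | s in K, t in L].

Definition cone K (v : T) : {fset {fset T}} := join K (simplex [fset v]).

Definition cdiff K L : {fset {fset T}} :=
  generated [fset s in facets K | s \notin L].

(* Here [B] is pure of dimension [d], so faces of cardinality [d] are those of
   codimension one. *)
Definition boundary (d : nat) (B : {fset {fset T}}) : {fset {fset T}} :=
  generated [fset t in B |
    (#|` t| == d) && (#|` [fset s in facets B | t `<=` s]| == 1)%N].

End Complexes.

Definition simplex_boundary (d : nat) : {fset {fset 'I_d.+2}} :=
  let A := [fset i | i in 'I_d.+2] in simplex A `\ A.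

(* The geometric realization of K is taken in barycentric coordinates, inside
   the space of functions T -> R, and polyhedra are given by finitely many
   non-strict affine inequalities.  A piecewise linear map on |K| is one that
   agrees with an affine map on each member of a finite cover of |K| by
   polyhedra; continuity is then automatic, since the cover is finite and
   closed. *)

Section PiecewiseLinear.
Variable R : realType.

Definition realization (T : choiceType) (K : {fset {fset T}}) (x : T -> R) :
    Prop :=
  (forall v, 0 <= x v) /\
  exists2 s, s \in K & (forall v, v \notin s -> x v = 0) /\
                       \sum_(v <- s) x v = 1.

Definition affine_form (T : choiceType) (V : {fset T}) (h : (T -> R) * R)
    (x : T -> R) : R :=
  \sum_(v <- V) h.1 v * x v + h.2.

Definition polyhedron (T : choiceType) (V : {fset T})
    (H : seq ((T -> R) * R)) (x : T -> R) : bool :=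
  all (fun h => affine_form V h x <= 0) H.

Definition PL_map (T U : choiceType) (K : {fset {fset T}})
    (L : {fset {fset U}}) (f : (T -> R) -> (U -> R)) : Prop :=
  (forall x, realization K x -> realization L (f x)) /\
  exists (N : nat) (P : 'I_N -> seq ((T -> R) * R))
         (a : 'I_N -> U -> (T -> R) * R),
    (forall x, realization K x -> exists i, polyhedron (vertices K) (P i) x) /\
    (forall i x, realization K x -> polyhedron (vertices K) (P i) x ->
       forall w, f x w = affine_form (vertices K) (a i w) x).

Definition PL_homeomorphic (T U : choiceType) (K : {fset {fset T}})
    (L : {fset {fset U}}) : Prop :=
  exists (f : (T -> R) -> (U -> R)) (g : (U -> R) -> (T -> R)),
    [/\ PL_map K L f, PL_map L K g,
        forall x, realization K x -> g (f x) = x &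
        forall y, realization L y -> f (g y) = y].

Definition combinatorial_sphere (d : nat) (T : choiceType)
    (K : {fset {fset T}}) : Prop :=
  is_complex K /\ PL_homeomorphic K (simplex_boundary d).

End PiecewiseLinear.

Definition V (m : nat) : {fset int} :=
  [fset i%:Z | i in iota 1 m] `|` [fset - i%:Z | i in iota 1 m].

Definition oppface (s : {fset int}) : {fset int} := [fset - v | v in s].

Definition oppcomplex (K : {fset {fset int}}) : {fset {fset int}} :=
  [fset oppface s | s in K].

Definition antipode_free (s : {fset int}) : bool :=
  all (fun v => - v \notin s) s.

Definition centrally_symmetric (K : {fset {fset int}}) : Prop :=
  forall s, s \in K -> oppface s \in K.

Definition cs_neighborly (i m : nat) (K : {fset {fset int}}) : Prop :=
  forall s : {fset int},
    s `<=` V m -> (#|` s| <= i)%N -> antipode_free s -> s \in K.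

Definition cross_boundary (m : nat) : {fset {fset int}} :=
  [fset s in simplex (V m) | antipode_free s].

(* Replaces B by bd B * v and -B by bd (-B) * (-v), for d-dimensional
   complexes. *)
Definition replace (d : nat) (D B : {fset {fset int}}) (v : int) :
    {fset {fset int}} :=
  cdiff D (B `|` oppcomplex B)
  `|` cone (boundary d B) v
  `|` cone (boundary d (oppcomplex B)) (- v).

Definition cycle_complex (s : seq int) : {fset {fset int}} :=
  generated [seq [fset v; next s v] | v <- s].

(* The complex obtained from the boundary of the (d + 1)-dimensional
   cross-polytope by k replacements, [B n] being the ball removed from the
   complex on [V n]. *)
Fixpoint iter_replace (d : nat) (B : nat -> {fset {fset int}}) (k : nat) :
    {fset {fset int}} :=
  if k is k'.+1 then
    let n := (d.+1 + k')%N in replace d (iter_replace d B k') (B n) n.+1%:Z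
  else cross_boundary d.+1.

(* [DeltaB d] is the pair of [n |-> Delta^d_n] and [i n |-> B^{d,i}_n].
   Dimension 0, n < d + 1 and i > ceil (d / 2) are junk values.  In [low], a
   negative upper index gives the void complex; [low] is used for
   i <= floor (d / 2), the only other case being i = ceil (d / 2), d odd. *)
Fixpoint DeltaB (d : nat) :
    (nat -> {fset {fset int}}) * (nat -> nat -> {fset {fset int}}) :=
  match d with
  | 0 => (fun=> fset0, fun _ _ => fset0)
  | d'.+1 =>
    let low (i n : nat) :=
      if d' is 0 then simplex [fset -1; n%:Z] else
      let B := (DeltaB d').2 in
      cone (B i n.-1) n%:Z
      `|` cone (oppcomplex (if i is i'.+1 then B i' n.-1 else fset0)) (- n%:Z)
    in
    let Delta (n : nat) :=
      if d' is 0 then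
        cycle_complex ([seq i%:Z | i <- iota 1 n] ++
                       [seq - i%:Z | i <- iota 1 n])
      else iter_replace d (low (uphalf d).-1) (n - d.+1)%N
    in
    (Delta,
     fun i n => if odd d && (i == uphalf d) then cdiff (Delta n) (low i.-1 n)
                else low i n)
  end.

Definition Delta (d n : nat) : {fset {fset int}} := (DeltaB d).1 n.

(* The sets i_1 < ... < i_p of the family, as increasing sequences; the entry
   of index j (from 0) is i_{j+1}. *)
Definition index_family (n : nat) (I : seq nat) : Prop :=
  [/\ sorted ltn I,
      all (fun i => 3 <= i <= n - 6)%N I &
      (2 <= size I)%N -> (1 < nth 0%N I 1 - nth 0%N I 0)%N].

(* The default value n - 2 of [nth] implements i_{p+1} := n - 2. *)
Definition BI_facets (n : nat) (I : seq nat) : seq {fset int} :=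
  let N := n%:Z in
  let idx j := nth (n - 2)%N I j in
  [seq [fset 1; 2; i%:Z; i%:Z + 2] | i <- index_iota 3 (n - 1)]
  ++ [:: [fset 1; 2; N - 1; N];
         [fset 1; - N + 2; N - 1; N];
         [fset 1; - N + 2; - N + 1; N];
         [fset 1; - N + 2; - N + 1; - N]]
  ++ [seq [fset - N + m%:Z + 1; - N + m%:Z; N - 1; N]
        | m <- index_iota 2 (idx 0%N).+1]
  ++ flatten [seq
       [fset 1; - N + (idx j)%:Z + 2; N - (idx j)%:Z - 1; N - (idx j)%:Z + 1]
       :: [seq [fset - N + m%:Z + 1; - N + m%:Z;
                     N - (idx j)%:Z - 1; N - (idx j)%:Z + 1]
             | m <- index_iota (idx j + 2) (idx j.+1).+1]
     | j <- iota 0 (size I)].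

Definition BI (n : nat) (I : seq nat) : {fset {fset int}} :=
  generated (BI_facets n I).

Definition DeltaI (n : nat) (I : seq nat) : {fset {fset int}} :=
  replace 3 (Delta 3 n) (BI n I) n.+1%:Z.

(* Main.v *)
Require Import Defs.
From mathcomp Require Import all_boot all_order all_algebra finmap.
From mathcomp Require Import reals boolp.
From mathcomp Require Import zify ring.

(* The balls involved are stacked: their facets can be listed so that each one
   adds a new vertex [w] to a triangle of an earlier one.  Replacing a stacked
   ball by the cone over its boundary is then a sequence of bistellar moves: the
   cone vertex first subdivides one facet, and then absorbs the facets one by
   one, exchanging a triangle with the edge joining [w] to the cone vertex.  The
   move is allowed because every triangle lies in at most two facets, a property
   preserved by bistellar moves, and because [w] is new.

   A bistellar move exchanging [A] and [B] is realized by the piecewise linear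
   map x |-> x + |A| min_A x (1_B / |B| - 1_A / |A|), whose inverse has the same
   form with [A] and [B] exchanged.

   All faces of codimension at least 2 of a stacked ball lie on its boundary, so
   coning off a stacked ball spanning all the vertices preserves
   cs-2-neighborliness and joins the new vertex to all the old ones.  Hence it
   suffices that [B^{3,1}_n] and [B(I)] are stacked balls of [Delta^3_n] which
   contain all the vertices and share no facet with their opposites. *)

Set Implicit Arguments.
Unset Strict Implicit.
Unset Printing Implicit Defensive.

Import Order.TTheory GRing.Theory Num.Theory.
Local Open Scope fset_scope.
Local Open Scope ring_scope.

(** * Piecewise linear maps *)

Section AffineForms.
Variables (R : realType) (T : choiceType).
Implicit Types (V s : {fset T}) (x : T -> R) (K : {fset {fset T}}).

Lemma sum_fset_supp V s x :
  (forall v, v \notin s -> x v = 0) -> (forall v, v \notin V -> x v = 0) ->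
  \sum_(v <- V) x v = \sum_(v <- s) x v.
Proof.
move=> xs xV; rewrite (big_fset_incl _ (fsubsetUl V s)) => [|v _ /xV //].
by rewrite -(big_fset_incl _ (fsubsetUr V s)) // => v _ /xs.
Qed.

Lemma realization0 K x v : realization K x -> v \notin vertices K -> x v = 0.
Proof.
case=> _ [s sK [xs _]] vK; apply: xs; apply: contra vK => vs.
by apply/bigfcupP; exists s; rewrite ?sK.
Qed.

Lemma sum_delta V a x : x a = 0 \/ a \in V ->
  \sum_(v <- V) (v == a)%:R * x v = x a.
Proof.
case: (boolP (a \in V)) => [aV _|aV [xa|//]].
  rewrite (big_fsetD1 a) //= eqxx mul1r big_seq big1 ?addr0 // => v.
  by rewrite !inE => /andP[/negPf-> _]; rewrite mul0r.
rewrite xa big_seq big1 // => v vV.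
by case: eqP => [va|_]; [rewrite -va vV in aV|rewrite mul0r].
Qed.

Lemma affine_coord K a x : realization K x ->
  affine_form (vertices K) (fun v => (v == a)%:R, 0) x = x a.
Proof.
move=> xK; rewrite /affine_form addr0 sum_delta //.
by case: (boolP (a \in vertices K)) => [|/(realization0 xK)]; [right|left].
Qed.

End AffineForms.

Section PLMaps.
Variable R : realType.

Lemma PL_map_cover (T U : choiceType) (K : {fset {fset T}}) (L : {fset {fset U}})
    (f : (T -> R) -> U -> R) (C : finType) (P : C -> seq ((T -> R) * R))
    (a : C -> U -> (T -> R) * R) :
  (forall x, realization K x -> realization L (f x)) ->
  (forall x, realization K x -> exists i, polyhedron (vertices K) (P i) x) ->
  (forall i x, realization K x -> polyhedron (vertices K) (P i) x ->
     forall w, f x w = affine_form (vertices K) (a i w) x) ->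
  PL_map K L f.
Proof.
move=> fKL cov faff; split=> //.
exists #|C|, (P \o enum_val), (a \o enum_val); split=> [x /cov[i xPi]|i x].
  by exists (enum_rank i); rewrite /= enum_rankK.
exact: faff.
Qed.

Lemma PL_map_comp (T U W : choiceType) (K : {fset {fset T}})
    (L : {fset {fset U}}) (M : {fset {fset W}})
    (f : (T -> R) -> U -> R) (g : (U -> R) -> W -> R) :
  PL_map K L f -> PL_map L M g -> PL_map K M (g \o f).
Proof.
case=> fKL [N1 [P1 [a1 [cov1 aff1]]]] [gLM [N2 [P2 [a2 [cov2 aff2]]]]].
pose pull i (h : (U -> R) * R) : (T -> R) * R :=
  (fun v => \sum_(w <- vertices L) h.1 w * (a1 i w).1 v,
   \sum_(w <- vertices L) h.1 w * (a1 i w).2 + h.2).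
have pullE i h x : realization K x -> polyhedron (vertices K) (P1 i) x ->
    affine_form (vertices K) (pull i h) x = affine_form (vertices L) h (f x).
  move=> xK xP; rewrite /affine_form /= addrA; congr (_ + _).
  under eq_bigr do rewrite mulr_suml.
  rewrite exchange_big -big_split /=; apply: eq_bigr => w _.
  rewrite (aff1 _ _ xK xP) /affine_form mulrDr mulr_sumr; congr (_ + _).
  by apply: eq_bigr => v _; rewrite mulrA.
pose P (c : 'I_N1 * 'I_N2) := P1 c.1 ++ [seq pull c.1 h | h <- P2 c.2].
have PE c x : realization K x -> polyhedron (vertices K) (P c) x =
    polyhedron (vertices K) (P1 c.1) x && polyhedron (vertices L) (P2 c.2) (f x).
  move=> xK; rewrite /polyhedron all_cat; case: (boolP (all _ (P1 _))) => //= xP.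
  by rewrite all_map; apply: eq_all => h /=; rewrite pullE.
apply: (@PL_map_cover _ _ _ _ _ _ P (fun c w => pull c.1 (a2 c.2 w))).
- by move=> x /fKL/gLM.
- move=> x xK; have [i xi] := cov1 x xK; have [j xj] := cov2 _ (fKL x xK).
  by exists (i, j); rewrite PE //= xi.
- move=> c x xK; rewrite PE // => /andP[xi xj] w.
  by rewrite pullE //= (aff2 _ _ (fKL x xK) xj).
Qed.

Lemma PL_homeomorphic_refl (T : choiceType) (K : {fset {fset T}}) :
  PL_homeomorphic R K K.
Proof.
suff idPL : PL_map K K (@id (T -> R)) by exists id, id.
apply: (@PL_map_cover _ _ _ _ _ unit (fun _ => [::])
  (fun _ w => (fun v => (v == w)%:R, 0))) => // _ x xK _ w.
by rewrite affine_coord.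
Qed.

Lemma PL_homeomorphic_sym (T U : choiceType) (K : {fset {fset T}})
    (L : {fset {fset U}}) :
  PL_homeomorphic R K L -> PL_homeomorphic R L K.
Proof. by case=> f [g [? ? ? ?]]; exists g, f; split. Qed.

Lemma PL_homeomorphic_trans (T U W : choiceType) (K : {fset {fset T}})
    (L : {fset {fset U}}) (M : {fset {fset W}}) :
  PL_homeomorphic R K L -> PL_homeomorphic R L M -> PL_homeomorphic R K M.
Proof.
case=> f [g [fPL gPL fK gK]] [f' [g' [f'PL g'PL f'K g'K]]].
exists (f' \o f), (g \o g'); split.
- exact: PL_map_comp fPL f'PL.
- exact: PL_map_comp g'PL gPL.
- by move=> x xK /=; rewrite f'K ?fK //; apply: fPL.1.
- by move=> y yM /=; rewrite gK ?g'K //; apply: g'PL.1.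
Qed.

Lemma PL_homeomorphic_rename (T U : choiceType) (e : U -> T)
    (L : {fset {fset U}}) : injective e ->
  PL_homeomorphic R [fset e @` (s : {fset U}) | s in L] L.
Proof.
move=> e_inj; set K := [fset _ | _ in _].
have eK u : (e u \in vertices K) = (u \in vertices L).
  apply/bigfcupP/bigfcupP=> -[s]; rewrite andbT.
    move=> /imfsetP[s' /= s'L ->]; rewrite mem_imfset //= => us.
    by exists s'; rewrite ?andbT.
  move=> sL us; exists (e @` s); last by rewrite mem_imfset.
  by rewrite andbT; apply: in_imfset.
pose f (x : T -> R) u := x (e u).
pose g (y : U -> R) t := \sum_(u <- vertices L) (e u == t)%:R * y u.
have ge y u : realization L y -> g y (e u) = y u.
  move=> yL; rewrite /g; under eq_bigr do rewrite (inj_eq e_inj).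
  by have := affine_coord u yL; rewrite /affine_form addr0.
have g0 y t : (forall u, u \in vertices L -> e u = t -> y u = 0) -> g y t = 0.
  move=> yt; rewrite /g big_seq big1 // => u uL.
  by case: eqP => [/yt-> //|]; rewrite ?mulr0 ?mul0r.
have fPL x : realization K x -> realization L (f x).
  case=> x0 [_ /imfsetP[s /= sL ->] [xs x1]]; split=> [u|]; first exact: x0.
  exists s => //; split=> [u us|]; first by apply: xs; rewrite mem_imfset.
  by rewrite -x1 big_imfset // => u v _ _; apply: e_inj.
have gPL y : realization L y -> realization K (g y).
  move=> yL; case: (yL) => y0 [s sL [ys y1]]; split=> [t|].
    by apply: sumr_ge0 => u _; rewrite mulr_ge0 // ler0n.
  exists (e @` s); first exact: in_imfset.
  split=> [t ts|].
    apply: g0 => u _ eut; apply: ys; apply: contra ts => us.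
    by rewrite -eut in_imfset.
  rewrite big_imfset /=; last by move=> u v _ _; apply: e_inj.
  by rewrite -y1; apply: eq_bigr => u _; rewrite ge.
exists f, g; split.
- apply: (@PL_map_cover _ _ _ _ _ unit (fun _ => [::])
    (fun _ u => (fun t => (t == e u)%:R, 0))) => // _ x xK _ u.
  by rewrite affine_coord.
- apply: (@PL_map_cover _ _ _ _ _ unit (fun _ => [::])
    (fun _ t => (fun u => (e u == t)%:R, 0))) => // _ y yL _ t.
  by rewrite /affine_form addr0.
- move=> x xK; apply: funext => t.
  have [[u eut]|nt] := pselect (exists u, e u = t).
    by rewrite -eut ge //; apply: fPL.
  rewrite g0 => [|u _ eut]; last by case: nt; exists u.
  case: xK => _ [_ /imfsetP[s /= sL ->] [xs _]]; rewrite xs //.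
  by apply/imfsetP=> -[u /= _ ute]; apply: nt; exists u.
- by move=> y yL; apply: funext => u; apply: ge.
Qed.

End PLMaps.

Section Flip.
Variables (R : realType) (T : choiceType).
Implicit Types (A B s : {fset T}) (x : T -> R) (K : {fset {fset T}}).

Definition fmin A x : R :=
  if enum_fset A is a :: r then \big[Order.min/x a]_(b <- r) x b else 0.

Lemma fmin_le A x a : a \in A -> fmin A x <= x a.
Proof.
rewrite /fmin -[a \in A]/(a \in enum_fset A); case: (enum_fset A) => // b r.
elim: r => [|c r IH]; first by rewrite inE big_nil => /eqP->.
rewrite big_cons ge_min !inE; case/or3P=> [ab|/eqP->|ar].
- by rewrite IH ?inE ?ab ?orbT.
- by rewrite lexx.
- by rewrite IH ?inE ?ar ?orbT.
Qed.

Lemma fmin_attained A x : A != fset0 -> exists2 a, a \in A & fmin A x = x a.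
Proof.
rewrite -cardfs_gt0 /fmin.
suff H b r : exists2 a, a \in b :: r & \big[Order.min/x b]_(c <- r) x c = x a.
  have: {subset enum_fset A <= A} by [].
  case: (enum_fset A) => // b r sA _; have [a /sA aA ->] := H b r.
  by exists a.
elim: r => [|c r [a ar IH]]; first by exists b; rewrite ?inE ?big_nil.
rewrite big_cons minEle; case: ifP => _.
  by exists c; rewrite ?inE ?eqxx ?orbT.
by exists a => //; move: ar; rewrite !inE => /orP[->|->]; rewrite ?orbT.
Qed.

Definition flip A B x : T -> R := fun v =>
  x v + fmin A x * (#|` A|%:R / #|` B|%:R * (v \in B)%:R - (v \in A)%:R).

(* Half of the data of a flip exchanging [A] and [B]: the star of [A] is the
   join of [A], of the boundary of [B] and of some complex [L], and it becomes
   the join of the boundary of [A], of [B] and of [L]. *)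
Definition flips_to A B K K' : Prop :=
  [/\ forall s, s \in K -> A `<=` s -> forall a, a \in A ->
        (s `\ a) `|` B \in K',
      forall s, s \in K -> ~~ (A `<=` s) -> s \in K' &
      forall s, s \in K -> ~~ (B `<=` s)].

Section OneSide.
Variables (A B : {fset T}) (K K' : {fset {fset T}}).
Hypotheses (A0 : A != fset0) (B0 : B != fset0) (AB : [disjoint A & B]%fset).
Hypothesis KK' : flips_to A B K K'.

Let cB : (#|` B|%:R : R) != 0.
Proof. by rewrite pnatr_eq0 cardfs_eq0. Qed.

Let cA : (#|` A|%:R : R) != 0.
Proof. by rewrite pnatr_eq0 cardfs_eq0. Qed.

Let notAB v : v \in A -> v \in B = false.
Proof. by move=> vA; move/fdisjointP: AB => /(_ v vA)/negbTE. Qed.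

Let notBA v : v \in B -> v \in A = false.
Proof. by move=> vB; apply/negP => /notAB; rewrite vB. Qed.

Let fminA_ge0 x : realization K x -> 0 <= fmin A x.
Proof. by case=> x0 _; have [a _ ->] := fmin_attained x A0. Qed.

Lemma flip_ge0 x v : realization K x -> 0 <= flip A B x v.
Proof.
move=> xK; have m0 := fminA_ge0 xK; case: xK => x0 _.
rewrite /flip; case: (boolP (v \in A)) => [vA|_].
  by rewrite notAB // mulr0 sub0r mulrN mulr1 subr_ge0 fmin_le.
by rewrite subr0 addr_ge0 // mulr_ge0 // mulr_ge0 // ?divr_ge0 // ler0n.
Qed.

Lemma flip_realization x : realization K x -> realization K' (flip A B x).
Proof.
move=> xK; split=> [v|]; first exact: flip_ge0.
case: KK' (xK) => k1 k2 k3 [x0 [s sK [xs x1]]].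
case: (boolP (A `<=` s)) => [As|nAs]; last first.
  exists s; first exact: k2.
  have m0 : fmin A x = 0.
    apply/eqP; rewrite eq_le fminA_ge0 // andbT.
    by have /fsubsetPn[a aA /xs <-] := nAs; apply: fmin_le.
  have fx v : flip A B x v = x v by rewrite /flip m0 mul0r addr0.
  by split=> [v /xs|]; rewrite ?fx // -x1; apply: eq_bigr => v _; rewrite fx.
have [a aA ma] := fmin_attained x A0.
have fs v : v \notin s `\ a `|` B -> flip A B x v = 0.
  rewrite !inE negb_or negb_and negbK => /andP[/orP[/eqP->|vs] vB].
    by rewrite /flip ma aA notAB // mulr0 sub0r mulrN mulr1 subrr.
  rewrite /flip xs // (negPf vB) mulr0 sub0r.
  by rewrite (negPf (contra (fsubsetP As v) vs)) oppr0 mulr0 addr0.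
exists (s `\ a `|` B); first exact: k1.
split=> //; rewrite -(@sum_fset_supp _ _ (s `|` B)) //; last first.
  move=> v; rewrite inE negb_or => /andP[vs vB]; apply: fs.
  by rewrite !inE (negPf vs) andbF.
rewrite big_split /= -mulr_sumr sumrB -mulr_sumr.
have count_in (S C : {fset T}) : C `<=` S ->
    \sum_(v <- S) ((v \in C)%:R : R) = #|` C|%:R.
  move=> CS; rewrite card_fset_sum1 natr_sum.
  rewrite (@sum_fset_supp _ _ _ C) => [|v /negPf-> //|v vS]; last first.
    by rewrite (negPf (contra (fsubsetP CS v) vS)).
  by rewrite !big_seq; apply: eq_bigr => v ->.
rewrite !count_in ?fsubsetUr ?(fsubset_trans As) ?fsubsetUl //.
rewrite divfK // subrr mulr0 addr0 -x1; apply: sum_fset_supp => // v.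
by rewrite inE negb_or => /andP[/xs].
Qed.

Lemma flipK x : realization K x -> flip B A (flip A B x) = x.
Proof.
move=> xK; case: KK' (xK) => k1 k2 k3 [x0 [s sK [xs x1]]].
have mB : fmin B (flip A B x) = fmin A x * (#|` A|%:R / #|` B|%:R).
  have fB b : b \in B -> flip A B x b = x b + fmin A x * (#|` A|%:R / #|` B|%:R).
    by move=> bB; rewrite /flip bB notBA // subr0 mulr1.
  apply/eqP; rewrite eq_le; apply/andP; split.
    have /fsubsetPn[b bB /xs xb] := k3 s sK.
    by have := fmin_le (flip A B x) bB; rewrite fB // xb add0r.
  have [b bB ->] := fmin_attained (flip A B x) B0.
  by rewrite fB // lerDr.
apply: funext => v; rewrite {1}/flip mB /flip -addrA -[RHS]addr0; congr (_ + _).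
by field; rewrite cA cB.
Qed.

Lemma flip_PL_map : A \in K -> PL_map K K' (flip A B).
Proof.
move=> AK; have [a0 a0A _] := fmin_attained (fun=> 0) A0.
pose P (a : A) : seq ((T -> R) * R) :=
  [seq (fun v => (v == val a)%:R - (v == b)%:R, 0) | b <- enum_fset A].
pose c w : R := #|` A|%:R / #|` B|%:R * (w \in B)%:R - (w \in A)%:R.
have aff2 x u v (r : R) : realization K x ->
    affine_form (vertices K) (fun t => (t == u)%:R + (t == v)%:R * r, 0) x =
    x u + x v * r.
  move=> xK; rewrite -[in RHS](affine_coord u xK) -[in RHS](affine_coord v xK).
  rewrite /affine_form /= !addr0 mulr_suml -big_split /=.
  by apply: eq_bigr => t _; rewrite mulrDl mulrAC.
have PE x a : realization K x ->
    polyhedron (vertices K) (P a) x = all (fun b => x (val a) <= x b) (enum_fset A).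
  move=> xK; rewrite /polyhedron all_map; apply: eq_all => b /=.
  rewrite -[RHS]subr_le0 -[x b]mulr1 -mulrN -(aff2 _ _ _ _ xK) /affine_form /=.
  by under [in RHS]eq_bigr do rewrite mulrN mulr1.
apply: (@PL_map_cover _ _ _ _ _ _ _ P
  (fun a w => (fun v => (v == w)%:R + (v == val a)%:R * c w, 0))).
- exact: flip_realization.
- move=> x xK; have [a aA ma] := fmin_attained x A0; exists [` aA].
  by rewrite PE //=; apply/allP => b bA; rewrite -ma; apply: fmin_le.
- move=> a x xK; rewrite PE // => /allP ale w; rewrite aff2 // /flip -/(c w).
  have [b bA mb] := fmin_attained x A0.
  suff -> : fmin A x = x (val a) by [].
  by apply/eqP; rewrite eq_le fmin_le ?fsvalP //= mb ale.
Qed.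

End OneSide.

Lemma flip_PL_homeomorphic A B K K' :
  A != fset0 -> B != fset0 -> [disjoint A & B]%fset -> A \in K -> B \in K' ->
  flips_to A B K K' -> flips_to B A K' K -> PL_homeomorphic R K K'.
Proof.
move=> A0 B0 AB AK BK' KK' K'K; have BA : [disjoint B & A]%fset by rewrite fdisjoint_sym.
exists (flip A B), (flip B A); split.
- exact: flip_PL_map.
- exact: flip_PL_map.
- exact: (flipK A0 B0 AB KK').
- exact: (flipK B0 A0 BA K'K).
Qed.

End Flip.

(** * Bistellar moves *)

Section Generated.
Variable T : choiceType.
Implicit Types (s t A B F : {fset T}) (L : seq {fset T}) (K : {fset {fset T}}).

Lemma in_generated L s :
  reflect (exists2 F, F \in L & s `<=` F) (s \in generated L).
Proof.
apply: (iffP (bigfcupP _ _ _ _)) => -[F FL sF]; exists F => //.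
- by case/andP: FL.
- by move: sF; rewrite fpowersetE.
- by rewrite FL.
- by rewrite fpowersetE.
Qed.

Lemma mem_generated L F : F \in L -> F \in generated L.
Proof. by move=> FL; apply/in_generated; exists F. Qed.

Lemma is_complex_generated L : is_complex (generated L).
Proof.
move=> s t /in_generated[F FL sF] ts; apply/in_generated; exists F => //.
exact: fsubset_trans sF.
Qed.

Lemma eq_generated L L' : L =i L' -> generated L = generated L'.
Proof.
move=> LL'; apply/fsetP => s; apply/in_generated/in_generated => -[F FL sF];
by exists F; rewrite // ?LL' // -LL'.
Qed.

Lemma generated_cat L L' : generated (L ++ L') = generated L `|` generated L'.
Proof. by rewrite /generated big_cat. Qed.

Lemma fsubset_pure d L s F : {in L, forall F, #|` F| = d} ->
  #|` s| = d -> F \in L -> s `<=` F -> s = F.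
Proof. by move=> Ld sd FL sF; apply/eqP; rewrite eqEfcard sF sd Ld /=. Qed.

Lemma facets_generated d L : {in L, forall F, #|` F| = d} ->
  facets (generated L) =i L.
Proof.
move=> Ld s; rewrite !inE /=; apply/andP/idP => [[sL /allP maxs]|sL].
  have /in_generated[F FL sF] := sL.
  by have := maxs F (mem_generated FL); rewrite sF => /eqP <-.
split; first exact: mem_generated.
apply/allP => t /in_generated[F FL tF]; apply/implyP => st.
have sF := fsubset_pure Ld (Ld _ sL) FL (fsubset_trans st tF).
by rewrite eqEfsubset st andbT sF.
Qed.

Lemma in_generated_pure d L F : {in L, forall F, #|` F| = d} ->
  #|` F| = d -> (F \in generated L) = (F \in L).
Proof.
move=> Ld Fd; apply/in_generated/idP => [[G GL FG]|FL]; last by exists F.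
by rewrite (fsubset_pure Ld Fd GL FG).
Qed.

Lemma cone_generated L v : cone (generated L) v = generated [seq v |` F | F <- L].
Proof.
apply/fsetP => s; apply/imfset2P/in_generated => /=.
  case=> F /in_generated[G GL FG] [t tv ->]; exists (v |` G).
    by apply/mapP; exists G.
  by rewrite fsetUC fsetUSS //; rewrite fpowersetE in tv.
case=> _ /mapP[F FL ->] sF; exists (s `\ v).
  by apply/in_generated; exists F => //; rewrite fsubDset.
exists (s `&` [fset v]); first by rewrite fpowersetE fsubsetIr.
by rewrite fsetUC fsetID.
Qed.

End Generated.

Section BistellarMoves.
Variables (R : realType) (T : choiceType).
Implicit Types (s t A B F : {fset T}) (L : seq {fset T}).

Definition boundary_facets A B : seq {fset T} :=
  [seq (A `|` B) `\ b | b <- enum_fset B].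

Lemma boundary_facets_flips A B L : [disjoint A & B]%fset ->
  {in L, forall F, ~~ (A `<=` F) && ~~ (B `<=` F)} ->
  flips_to A B (generated (boundary_facets A B ++ L))
               (generated (boundary_facets B A ++ L)).
Proof.
move=> AB LAB; split.
- move=> s /in_generated[F + sF] As a aA; rewrite mem_cat => /orP[|/LAB]; last first.
    by rewrite (fsubset_trans As sF).
  case/mapP => b bB FE; apply/in_generated; exists ((B `|` A) `\ a).
    by rewrite mem_cat; apply/orP; left; apply: (map_f (fun a => (B `|` A) `\ a)).
  apply/fsubsetP => v; move/fsubsetP: sF => /(_ v); rewrite FE !inE.
  case: (v =P a) => [->|_] /=.
    by move=> _ aB; move/fdisjointP: AB => /(_ a aA); rewrite aB.
  case: (v \in B); case: (v \in A); rewrite ?orbT ?orbF //=.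
  by move=> vs /vs; rewrite andbF.
- move=> s /in_generated[F + sF] nAs; rewrite mem_cat => /orP[|FL]; last first.
    by apply/in_generated; exists F; rewrite // mem_cat FL orbT.
  case/mapP => b bB FE; have /fsubsetPn[a aA nas] := nAs.
  apply/in_generated; exists ((B `|` A) `\ a).
    by rewrite mem_cat; apply/orP; left; apply: (map_f (fun a => (B `|` A) `\ a)).
  apply/fsubsetP => v vs; move/fsubsetP: sF => /(_ v vs); rewrite FE !inE.
  case: (v =P a) => [va|_]; first by rewrite va (negPf nas) in vs.
  by case/andP=> _; rewrite orbC => ->.
- move=> s /in_generated[F + sF]; rewrite mem_cat => /orP[|/LAB/andP[_]]; last first.
    by apply: contra => Bs; apply: fsubset_trans sF.
  case/mapP => b bB FE; apply/fsubsetPn; exists b => //.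
  by apply/negP => /(fsubsetP sF); rewrite FE !inE eqxx.
Qed.

Lemma bistellar_PL A B L : A != fset0 -> B != fset0 -> [disjoint A & B]%fset ->
  {in L, forall F, ~~ (A `<=` F) && ~~ (B `<=` F)} ->
  PL_homeomorphic R (generated (boundary_facets A B ++ L))
                    (generated (boundary_facets B A ++ L)).
Proof.
move=> A0 B0 AB LAB; have BA : [disjoint B & A]%fset by rewrite fdisjoint_sym.
have gen C D : D != fset0 -> [disjoint C & D]%fset ->
    C \in generated (boundary_facets C D ++ L).
  move=> /fset0Pn[x xD] /fdisjointP CD.
  apply/in_generated; exists ((C `|` D) `\ x).
    rewrite mem_cat; apply/orP; left.
    exact: (map_f (fun x => (C `|` D) `\ x)).
  apply/fsubsetP => v vC; rewrite !inE vC; case: (v =P x) => //= vx.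
  by have := CD v vC; rewrite vx xD.
apply: (flip_PL_homeomorphic R A0 B0 AB); rewrite ?gen //.
  exact: boundary_facets_flips.
by apply: boundary_facets_flips => // F /LAB; rewrite andbC.
Qed.

Definition pseudomanifold d L : Prop :=
  [/\ uniq L, {in L, forall F, #|` F| = d.+1} &
      forall t, #|` t| = d -> (count (fun F => t `<=` F) L <= 2)%N].

Lemma pseudomanifold_perm d L L' :
  perm_eq L L' -> pseudomanifold d L -> pseudomanifold d L'.
Proof.
move=> LL' [Lu Ld Lc]; split; first by rewrite -(perm_uniq LL').
  by move=> F; rewrite -(perm_mem LL'); apply: Ld.
by move=> t /Lc; rewrite (permP LL').
Qed.

Lemma count_notin A t : count (fun a => a \notin t) (enum_fset A) = #|` A `\` t|.
Proof.
rewrite -size_filter; apply: perm_size; apply: uniq_perm.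
- by rewrite filter_uniq.
- exact: fset_uniq.
- by move=> a; rewrite mem_filter !inE.
Qed.

Lemma count_boundary_facets A B t :
  count (fun F => t `<=` F) (boundary_facets A B) =
  if t `<=` A `|` B then #|` B `\` t| else 0%N.
Proof.
rewrite count_map -count_notin; case: ifP => tAB.
  by apply: eq_count => b /=; rewrite fsubsetD1 tAB.
by rewrite (eq_count (a2 := pred0)) ?count_pred0 // => b /=; rewrite fsubsetD1 tAB.
Qed.

Lemma bistellar_pseudomanifold d A B L : [disjoint A & B]%fset ->
  #|` A `|` B| = d.+2 ->
  {in L, forall F, ~~ (B `<=` F)} ->
  pseudomanifold d (boundary_facets A B ++ L) ->
  pseudomanifold d (boundary_facets B A ++ L).
Proof.
move=> AB cAB LB [Lu Ld Lc]; split.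
- move: Lu; rewrite !cat_uniq => /and3P[_ _ ->]; rewrite andbT; apply/andP; split.
    rewrite map_inj_in_uniq ?fset_uniq // => a a' aA a'A /fsetP/(_ a).
    by rewrite !inE eqxx /= aA orbT andbT => /esym/negbFE/eqP.
  apply/hasPn => F FL; apply: contra (LB F FL) => /mapP[a aA ->].
  apply/fsubsetP => b bB; rewrite !inE bB andbT; apply: contraTneq bB => ->.
  by move/fdisjointP: AB; apply.
- move=> F; rewrite mem_cat => /orP[/mapP[a aA ->]|FL]; last first.
    by apply: Ld; rewrite mem_cat FL orbT.
  by have := cardfsD1 a (B `|` A); rewrite fsetUC cAB inE aA /= => -[].
move=> t td; have := Lc t td; rewrite !count_cat !count_boundary_facets fsetUC.
case: ifP => // tAB.
have cardAB : (#|` A `\` t| + #|` B `\` t| = 2)%N.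
  have -> : (2 = #|` (A `|` B) `\` t|)%N.
    by rewrite cardfsDS 1?fsetUC // fsetUC cAB td; lia.
  rewrite fsetDUl cardfsU; suff -> : (A `\` t) `&` (B `\` t) = fset0.
    by rewrite cardfs0 subn0.
  apply/fsetP => v; rewrite !inE; case: (boolP (v \in A)) => vA; rewrite ?andbF //.
  by move/fdisjointP: AB => /(_ v vA)/negPf->; rewrite ?andbF.
case: (posnP #|` B `\` t|) => [|Bt]; last by lia.
move/eqP; rewrite cardfs_eq0 => /eqP Bt _.
rewrite (eq_in_count (a2 := pred0)) ?count_pred0; last first.
  move=> F /LB; apply: contraNF => tF; apply: fsubset_trans tF.
  by rewrite -fsetD_eq0 Bt.
by move: cardAB; rewrite Bt cardfs0; lia.
Qed.

End BistellarMoves.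

(** * Stacked balls *)

Section StackedBalls.
Variables (R : realType) (T : choiceType).
Implicit Types (s t F G : {fset T}) (L B : seq {fset T}) (v w : T).

Inductive stacked : seq {fset T} -> Prop :=
| stacked_one F : stacked [:: F]
| stacked_cons F w B : stacked B -> w \in F ->
    {in B, forall G, w \notin G} -> (exists2 G, G \in B & F `\ w `<=` G) ->
    stacked (F :: B).

Lemma stacked_uniq B : stacked B -> uniq B.
Proof.
elim=> {B} // F w B _ uB wF wB _; rewrite /= uB andbT.
by apply/negP => /wB; rewrite wF.
Qed.

Definition ball_boundary d B : {fset {fset T}} :=
  [fset t in generated B |
    (#|` t| == d) && (count (fun F => t `<=` F) B == 1)%N].

Lemma in_ball_boundary d B t : (t \in ball_boundary d B) =
  (#|` t| == d) && (count (fun F => t `<=` F) B == 1)%N.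
Proof.
rewrite !inE /= andbC; case: eqP => //= _; case: eqP => //= B1.
have /hasP[F FB tF] : has (fun F => t `<=` F) B by rewrite has_count B1.
by apply/in_generated; exists F.
Qed.

Lemma ball_boundary_sub d B t : t \in ball_boundary d B ->
  exists2 F, F \in B & t `<=` F.
Proof. by rewrite inE => /andP[/in_generated]. Qed.

Lemma ball_boundaryP d B F t : uniq B -> F \in B -> t `<=` F -> #|` t| = d ->
  {in B, forall G, t `<=` G -> G = F} -> t \in ball_boundary d B.
Proof.
move=> uB FB tF td tB; rewrite in_ball_boundary td eqxx /=.
rewrite (eq_in_count (a2 := pred1 F)) ?count_uniq_mem ?FB // => G GB /=.
by apply/idP/eqP => [/(tB _ GB)|->].
Qed.

Lemma mem_boundary1 d F t : #|` F| = d.+1 ->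
  (t \in ball_boundary d [:: F]) = (t \in [seq F `\ a | a <- enum_fset F]).
Proof.
move=> Fd; rewrite in_ball_boundary /= addn0 eqb1.
apply/andP/mapP => [[/eqP td tF]|[a aF ->]].
  have : (0 < #|` F `\` t|)%N by rewrite cardfsDS // Fd td subSnn.
  rewrite cardfs_gt0 => /fset0Pn[a]; rewrite inE => /andP[nat aF].
  exists a => //; apply/eqP; rewrite eqEfcard fsubsetD1 tF nat td /=.
  by have := cardfsD1 a F; rewrite Fd aF => -[->].
by rewrite fsubsetDl; have := cardfsD1 a F; rewrite Fd aF => -[->]; rewrite eqxx.
Qed.

Lemma pseudomanifold_catl d B L : pseudomanifold d (B ++ L) -> pseudomanifold d B.
Proof.
case=> uBL BLd BLc; split; first by move: uBL; rewrite cat_uniq => /and3P[].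
  by move=> F FB; apply: BLd; rewrite mem_cat FB.
by move=> t /BLc; apply: leq_trans; rewrite count_cat leq_addr.
Qed.

Section Attach.
Variables (d : nat) (F : {fset T}) (w : T) (B : seq {fset T}).
Hypotheses (wF : w \in F) (wB : {in B, forall G, w \notin G}).
Hypothesis FB : exists2 G, G \in B & F `\ w `<=` G.
Hypothesis mB : pseudomanifold d (F :: B).

Lemma card_attach : #|` F `\ w| = d.
Proof.
case: mB => _ /(_ F (mem_head _ _)) Fd _.
by have := cardfsD1 w F; rewrite Fd wF => -[].
Qed.

(* [F] and its parent are the at most two facets containing the face [F `\ w]. *)
Lemma attach_in_boundary : F `\ w \in ball_boundary d B.
Proof.
rewrite in_ball_boundary card_attach eqxx /= eqn_leq -has_count.
apply/andP; split; last by apply/hasP; case: FB => G; exists G.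
by case: mB => _ _ /(_ _ card_attach) /=; rewrite fsubsetDl.
Qed.

Lemma mem_boundary_attach t : (t \in ball_boundary d (F :: B)) =
  (t \in [seq F `\ a | a <- enum_fset (F `\ w)]) ||
  (t \in ball_boundary d B) && (t != F `\ w).
Proof.
have Fd : #|` F| = d.+1 by case: mB => _ ->; rewrite ?mem_head.
have faces : (t \in [seq F `\ a | a <- enum_fset (F `\ w)]) =
    [&& t \in ball_boundary d [:: F] & w \in t].
  rewrite (mem_boundary1 _ Fd); apply/mapP/andP => [[a]|[/mapP[a aF ->]]].
    rewrite in_fsetD1 => /andP[aw aF] ->; rewrite !inE eq_sym aw wF.
    by split=> //; apply: map_f.
  by rewrite !inE => /andP[wa _]; exists a; rewrite // !inE eq_sym wa.
rewrite faces; case: (boolP (w \in t)) => wt; last first.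
  rewrite andbF /= !in_ball_boundary /=.
  case: (boolP (t `<=` F)) => tF; last first.
    rewrite add0n; case: (t =P F `\ w) => [tE|]; last by rewrite andbT.
    by rewrite tE fsubsetDl in tF.
  have tFw : t `<=` F `\ w by rewrite fsubsetD1 tF.
  case: (#|` t| =P d) => //= td; have tE : t = F `\ w.
    by apply/eqP; rewrite eqEfcard tFw td card_attach /=.
  rewrite tE eqxx andbF.
  by have := attach_in_boundary; rewrite in_ball_boundary => /andP[_ /eqP->].
have B0 : count (fun G => t `<=` G) B = 0%N.
  rewrite (eq_in_count (a2 := pred0)) ?count_pred0 // => G GB.
  by apply: contraNF (wB GB) => /fsubsetP/(_ w wt).
by rewrite andbT !in_ball_boundary /= B0 /= andbF orbF.
Qed.

Lemma perm_boundary_attach : perm_eq (ball_boundary d (F :: B))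
  ([seq F `\ a | a <- enum_fset (F `\ w)] ++ rem (F `\ w) (ball_boundary d B)).
Proof.
apply: uniq_perm; first exact: fset_uniq.
  rewrite cat_uniq rem_uniq ?fset_uniq // map_inj_in_uniq ?fset_uniq /= ?andbT.
    apply/hasPn => t; rewrite mem_rem_uniq ?fset_uniq // inE.
    case/andP=> _ /ball_boundary_sub[G /wB wG tG].
    apply: contra wG => /mapP[a]; rewrite in_fsetD1 => /andP[aw aF] tE.
    by apply: (fsubsetP tG); rewrite tE !inE wF eq_sym aw.
  move=> a b; rewrite !inE => /andP[_ aF] _ /fsetP/(_ a).
  by rewrite !inE eqxx aF /= andbT => /esym/negbFE/eqP.
move=> t; rewrite mem_cat mem_rem_uniq ?fset_uniq // mem_boundary_attach.
by rewrite [in RHS]inE andbC.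
Qed.

End Attach.

Lemma stacked_low_faces d B s : stacked B -> pseudomanifold d B ->
  s \in generated B -> (#|` s| < d)%N -> s \in generated (ball_boundary d B).
Proof.
move=> stB; elim: stB => {B} [F|F w B _ IH wF wB FB] mB sB sd.
  have /in_generated[G] := sB; rewrite inE => /eqP-> sF.
  have Fd : #|` F| = d.+1 by case: mB => _ ->; rewrite ?mem_head.
  have : (0 < #|` F `\` s|)%N by rewrite cardfsDS // Fd; lia.
  rewrite cardfs_gt0 => /fset0Pn[a]; rewrite inE => /andP[nas aF].
  apply/in_generated; exists (F `\ a); last by rewrite fsubsetD1 sF.
  by rewrite (mem_boundary1 _ Fd); apply: (map_f (fun a => F `\ a)).
have newface : s `<=` F -> s \in generated (ball_boundary d (F :: B)).
  move=> sF; have Fwd := card_attach wF mB.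
  have : (0 < #|` (F `\ w) `\` s|)%N.
    rewrite cardfsD Fwd subn_gt0; apply: leq_ltn_trans sd.
    exact/fsubset_leq_card/fsubsetIr.
  rewrite cardfs_gt0 => /fset0Pn[a]; rewrite inE => /andP[nas aF].
  apply/in_generated; exists (F `\ a); last by rewrite fsubsetD1 sF.
  rewrite (mem_boundary_attach wF wB FB mB).
  by apply/orP; left; apply: (map_f (fun a => F `\ a)).
have /in_generated[G] := sB; rewrite inE => /predU1P[->//|GB sG].
have mB' : pseudomanifold d B.
  apply: (@pseudomanifold_catl _ _ [:: F]); apply: pseudomanifold_perm mB.
  by rewrite perm_sym perm_catC.
have /in_generated[t tB st] : s \in generated (ball_boundary d B).
  by apply: IH => //; apply/in_generated; exists G.
case: (t =P F `\ w) => [tE|/eqP tF].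
  by apply: newface; apply: (fsubset_trans st); rewrite tE fsubsetDl.
apply/in_generated; exists t => //.
by rewrite (mem_boundary_attach wF wB FB mB) tB tF orbT.
Qed.

Definition cone_facets v (S : seq {fset T}) := [seq v |` t | t <- S].

Lemma stacked_cone d B L v : (0 < d)%N -> stacked B ->
  pseudomanifold d (B ++ L) -> {in B ++ L, forall F, v \notin F} ->
  PL_homeomorphic R (generated (B ++ L))
    (generated (cone_facets v (ball_boundary d B) ++ L)) /\
  pseudomanifold d (cone_facets v (ball_boundary d B) ++ L).
Proof.
move=> d0 stB; elim: stB L => {B} [F|F w B stB IH wF wB FB] L mBL vBL.
  have Fd : #|` F| = d.+1 by case: mBL => _ ->; rewrite ?mem_head.
  have vF : v \notin F by apply: vBL; rewrite mem_head.
  have Fv : [disjoint F & [fset v]]%fset by rewrite fdisjointX1.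
  have cFv : #|` F `|` [fset v]| = d.+2 by rewrite fsetUC cardfsU1 vF Fd.
  have P1 : perm_eq ([:: F] ++ L) (boundary_facets F [fset v] ++ L).
    rewrite perm_cat2r /boundary_facets.
    have -> : enum_fset [fset v] = [:: v] by apply: perm_small_eq => //; apply: uniq_perm => // x; rewrite !inE.
    by rewrite /= fsetUC fsetU1K.
  have P2 : perm_eq (boundary_facets [fset v] F ++ L)
      (cone_facets v (ball_boundary d [:: F]) ++ L).
    rewrite perm_cat2r.
    have -> : boundary_facets [fset v] F =
        cone_facets v [seq F `\ a | a <- enum_fset F].
      rewrite /cone_facets -map_comp; apply/eq_in_map => a aF /=.
      apply/fsetP => x; rewrite !inE; case: (x =P v) => //= ->.
      by rewrite andbT; apply: contraNneq vF => ->.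
    apply: perm_map; apply: uniq_perm; last by move=> t; rewrite mem_boundary1.
      rewrite map_inj_in_uniq ?fset_uniq // => a b aF _ /fsetP/(_ a).
      by rewrite !inE eqxx aF /= andbT => /esym/negbFE/eqP.
    exact: fset_uniq.
  have side : {in L, forall G, ~~ (F `<=` G) && ~~ ([fset v] `<=` G)}.
    move=> G GL; rewrite fsub1set vBL ?mem_cat ?GL ?orbT // andbT.
    apply/negP => FG; case: mBL => [+ BLd _]; rewrite /= => /andP[+ _].
    suff -> : F = G by rewrite GL.
    by apply: (fsubset_pure BLd Fd _ FG); rewrite mem_cat GL orbT.
  split.
    rewrite (eq_generated (perm_mem P1)) -(eq_generated (perm_mem P2)).
    by apply: bistellar_PL; rewrite // -cardfs_gt0 ?Fd ?cardfs1.
  apply: pseudomanifold_perm P2 _; apply: bistellar_pseudomanifold => //.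
    by move=> G /side/andP[].
  exact: pseudomanifold_perm P1 mBL.
have vF : v \notin F by apply: vBL; rewrite mem_head.
have vw : v != w by apply: contraNneq vF => ->.
have PFB : perm_eq ((F :: B) ++ L) (B ++ F :: L).
  by rewrite -[F :: L]cat1s perm_sym perm_catCA.
have mFB : pseudomanifold d (F :: B) by apply: pseudomanifold_catl mBL.
have Fd : #|` F| = d.+1 by case: mBL => _ ->; rewrite ?mem_head.
set s := F `\ w; have sd : #|` s| = d by apply: card_attach wF mFB.
have [|PL1 m1] := IH (F :: L) (pseudomanifold_perm PFB mBL).
  by move=> G; rewrite -(perm_mem PFB); apply: vBL.
set L0 := cone_facets v (rem s (ball_boundary d B)) ++ L.
have ws : w \notin s by rewrite !inE eqxx.
have vs : v \notin s by rewrite !inE (negPf vF) andbF.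
have dsj : [disjoint s & [fset v; w]]%fset.
  by rewrite fdisjoint_sym fdisjointU1X vs fdisjoint1X.
have cs : #|` s `|` [fset v; w]| = d.+2.
  rewrite cardfsU (eqP (_ : s `&` [fset v; w] == fset0)).
    by rewrite cardfs0 subn0 sd cardfs2 vw addn2.
  by rewrite -/(fdisjoint _ _).
have Q1 : perm_eq (cone_facets v (ball_boundary d B) ++ F :: L)
    (boundary_facets s [fset v; w] ++ L0).
  have -> : F :: L = [:: F] ++ L by [].
  rewrite /L0 !catA perm_cat2r perm_catC.
  have sB : s \in ball_boundary d B by apply: attach_in_boundary.
  have /= Q := perm_map (fun t => v |` t) (perm_to_rem sB).
  apply: (@perm_trans _ ([:: F; v |` s] ++ cone_facets v (rem s (ball_boundary d B)))).
    by rewrite /= perm_cons.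
  rewrite perm_cat2r perm_sym.
  have E : perm_eq (enum_fset [fset v; w]) [:: v; w].
    by apply: uniq_perm => [||x]; rewrite ?fset_uniq //= ?inE ?vw // !inE.
  apply: perm_trans (perm_map _ E) _; rewrite /=.
  have -> : (s `|` [fset v; w]) `\ v = F.
    apply/fsetP => x; rewrite !inE; case: (x =P v) => [->|_] /=; first by rewrite (negPf vF).
    by case: (x =P w) => [->|_]; rewrite ?orbT ?orbF.
  have -> // : (s `|` [fset v; w]) `\ w = v |` s.
  apply/fsetP => x; rewrite !inE; case: (x =P w) => [->|_] /=; last by rewrite orbC orbF.
  by rewrite eq_sym (negPf vw).
have Q2 : perm_eq (boundary_facets [fset v; w] s ++ L0)
    (cone_facets v (ball_boundary d (F :: B)) ++ L).
  rewrite /L0 catA perm_cat2r perm_sym.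
  apply: perm_trans (perm_map _ (perm_boundary_attach wF wB FB mFB)) _.
  rewrite map_cat perm_cat2r -map_comp.
  suff -> : boundary_facets [fset v; w] s =
      [seq v |` (F `\ a) | a <- enum_fset s] by [].
  apply/eq_in_map => a as_ /=.
  have [aw aF] : a != w /\ a \in F by move: as_; rewrite !inE => /andP[].
  apply/fsetP => x; rewrite !inE; case: (x =P v) => [->|_] /=.
    by rewrite andbT; apply: contraNneq vF => ->.
  by case: (x =P w) => [->|_] //=; rewrite wF andbT.
have m2 := pseudomanifold_perm Q1 m1.
have side : {in L0, forall G, ~~ (s `<=` G) && ~~ ([fset v; w] `<=` G)}.
  move=> G GL0; apply/andP; split.
    case: m2 => _ _ /(_ s sd); rewrite count_cat count_boundary_facets fsubsetUl.
    have -> : [fset v; w] `\` s = [fset v; w].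
      by apply/fsetDidPl; rewrite fdisjoint_sym.
    rewrite cardfs2 vw -[leqRHS]addn0 leq_add2l leqn0 eqn0Ngt -has_count.
    by move/hasPn/(_ G GL0).
  rewrite fsubUset !fsub1set negb_and; move: GL0.
  rewrite mem_cat => /orP[/mapP[t /mem_rem tB ->]|GL]; last first.
    by rewrite vBL // mem_cat GL orbT.
  apply/orP; right; rewrite !inE negb_or eq_sym vw /=.
  have [G' /wB wG' tG'] := ball_boundary_sub tB.
  by apply: contra wG'; apply: (fsubsetP tG').
split.
  rewrite (eq_generated (perm_mem PFB)); apply: PL_homeomorphic_trans PL1 _.
  rewrite (eq_generated (perm_mem Q1)) -(eq_generated (perm_mem Q2)).
  by apply: bistellar_PL; rewrite // -cardfs_gt0 ?sd ?cardfs2.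
apply: pseudomanifold_perm Q2 _; apply: bistellar_pseudomanifold => //.
by move=> G /side/andP[].
Qed.

End StackedBalls.

(** * Centrally symmetric replacements *)

Section Antipodal.
Implicit Types (s t F G : {fset int}) (L B : seq {fset int}) (v w x : int).

Lemma mem_oppface v s : (v \in oppface s) = (- v \in s).
Proof.
apply/imfsetP/idP => [[x /= xs ->]|vs]; first by rewrite opprK.
by exists (- v); rewrite ?opprK.
Qed.

Lemma oppfaceK : involutive oppface.
Proof. by move=> s; apply/fsetP => x; rewrite !mem_oppface opprK. Qed.

Lemma card_oppface s : #|` oppface s| = #|` s|.
Proof. by rewrite card_imfset //; apply: oppr_inj. Qed.

Lemma oppface_subset s t : (oppface s `<=` oppface t) = (s `<=` t).
Proof.
have sub s' t' : s' `<=` t' -> oppface s' `<=` oppface t'.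
  by move/fsubsetP=> st; apply/fsubsetP => x; rewrite !mem_oppface => /st.
by apply/idP/idP => /sub //; rewrite !oppfaceK.
Qed.

Lemma oppfaceU s t : oppface (s `|` t) = oppface s `|` oppface t.
Proof. exact: imfsetU. Qed.

Lemma oppface1 v : oppface [fset v] = [fset - v].
Proof. exact: imfset_fset1. Qed.

Lemma mem_map_oppface s B : (s \in map oppface B) = (oppface s \in B).
Proof. by rewrite -{1}(oppfaceK s) mem_map //; apply: can_inj oppfaceK. Qed.

Lemma oppcomplex_generated B :
  oppcomplex (generated B) = generated (map oppface B).
Proof.
apply/fsetP => s; apply/imfsetP/in_generated => /= [[t]|[_ /mapP[F FB ->] sF]].
  case/in_generated => F FB tF ->; exists (oppface F); first exact: map_f.
  by rewrite oppface_subset.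
exists (oppface s); last by rewrite oppfaceK.
by apply/in_generated; exists F; rewrite // -oppface_subset oppfaceK.
Qed.

Lemma oppcomplex0 : oppcomplex fset0 = fset0.
Proof. exact: imfset0. Qed.

Lemma stacked_oppface B : stacked B -> stacked (map oppface B).
Proof.
elim=> [F|F w {}B _ stB wF wB [G GB FG]]; first exact: stacked_one.
apply: (@stacked_cons _ _ (- w)) => //; first by rewrite mem_oppface opprK.
  by move=> _ /mapP[H HB ->]; rewrite mem_oppface opprK wB.
exists (oppface G); first exact: map_f.
suff -> : oppface F `\ - w = oppface (F `\ w) by rewrite oppface_subset.
by apply/fsetP => x; rewrite !(inE, mem_oppface) eqr_oppLR.
Qed.

Lemma mem_ball_boundary_oppface d B t :
  (t \in ball_boundary d (map oppface B)) = (oppface t \in ball_boundary d B).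
Proof.
rewrite !in_ball_boundary card_oppface count_map; congr (_ && (_ == _)).
by apply: eq_count => F /=; rewrite -{1}(oppfaceK t) oppface_subset.
Qed.

Lemma boundary_generated d B : {in B, forall F, #|` F| = d.+1} -> uniq B ->
  boundary d (generated B) = generated (ball_boundary d B).
Proof.
move=> Bd uB; apply: eq_generated => t; rewrite !inE /=.
congr [&& _, _ & _ == _]; rewrite -size_filter; apply: perm_size.
apply: uniq_perm; rewrite ?fset_uniq ?filter_uniq // => F.
by rewrite mem_filter !inE /= andbC -(facets_generated Bd) !inE.
Qed.

Definition replace_facets d L B v : seq {fset int} :=
  [seq F <- L | (F \notin B) && (oppface F \notin B)]
  ++ cone_facets v (ball_boundary d B)
  ++ cone_facets (- v) (ball_boundary d (map oppface B)).

Lemma replace_generated d L B v : {in L, forall F, #|` F| = d.+1} ->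
  {in B, forall F, #|` F| = d.+1} -> uniq B ->
  replace d (generated L) (generated B) v = generated (replace_facets d L B v).
Proof.
move=> Ld Bd uB; have uB' : uniq (map oppface B).
  by rewrite map_inj_uniq //; apply: can_inj oppfaceK.
have Bd' : {in map oppface B, forall F, #|` F| = d.+1}.
  by move=> F; rewrite mem_map_oppface => /Bd; rewrite card_oppface.
rewrite /replace oppcomplex_generated !boundary_generated // !cone_generated.
rewrite /replace_facets !generated_cat fsetUA; congr (_ `|` _ `|` _).
have in_filter (X : {fset {fset int}}) (P : pred {fset int}) F :
  (F \in [fset s in X | P s]) = (F \in X) && P F by rewrite !inE.
apply: eq_generated => F; rewrite mem_filter in_filter (facets_generated Ld) andbC.
case: (boolP (F \in L)) => FL; rewrite ?andbF // !andbT inE negb_or.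
by rewrite !(in_generated_pure _ (Ld F FL)) // mem_map_oppface.
Qed.

Lemma mem_V m x : (x \in V m) = (0 < `|x| <= m)%N.
Proof.
rewrite inE; apply/orP/idP.
  by case=> /imfsetP[i /=]; rewrite mem_iota => ? ->; lia.
move=> xm; have [x0|x0] := lerP 0 x; [left|right]; apply/imfsetP;
  by exists `|x|%N; rewrite /= ?mem_iota; lia.
Qed.

Record cs_sphere (R : realType) d n L : Prop := CsSphere {
  cs_pseudomanifold : pseudomanifold d L;
  cs_subset : {in L, forall F, F `<=` V n};
  cs_oppface : {in L, forall F, oppface F \in L};
  cs_PL : PL_homeomorphic R (generated L) (simplex_boundary d);
  cs_neighborly2 : cs_neighborly 2 n (generated L) }.

Record cs_stacked n L B : Prop := CsStacked {
  cs_stacked_ball : stacked B;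
  cs_stacked_sub : {subset B <= L};
  cs_stacked_opp : {in B, forall F, oppface F \notin B};
  cs_stacked_span : forall x, x \in V n -> exists2 F, F \in B & x \in F }.

Lemma cs_sphere_replace (R : realType) d n L B : (2 < d)%N ->
  cs_sphere R d n L -> cs_stacked n L B ->
  cs_sphere R d n.+1 (replace_facets d L B n.+1%:Z).
Proof.
move=> d2 [mL LV LO PL nb] [stB BL BO Bspan].
have d0 : (0 < d)%N by apply: leq_trans d2.
have uB := stacked_uniq stB; set v : int := n.+1%:Z.
set L0 := [seq F <- L | (F \notin B) && (oppface F \notin B)].
have [uL Ld Lc] := mL.
have P1 : perm_eq L (B ++ (map oppface B ++ L0)).
  apply: uniq_perm => //.
    rewrite !cat_uniq uB filter_uniq // map_inj_uniq ?uB /=; last exact: can_inj oppfaceK.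
    rewrite andbT has_cat negb_or; apply/andP; split; last first.
      by apply/hasPn => F; rewrite mem_filter mem_map_oppface => /andP[/andP[]].
    apply/andP; split; apply/hasPn => F.
      by rewrite mem_map_oppface => /BO; rewrite oppfaceK.
    by rewrite mem_filter => /andP[/andP[]].
  move=> F; rewrite !mem_cat mem_map_oppface mem_filter.
  case: (boolP (F \in B)) => [/BL//|FB].
  by case: (boolP (oppface F \in B)) => [/BL/LO|//]; rewrite oppfaceK.
have vnew u F : F \in L -> (u == v) || (u == - v) -> u \notin F.
  move=> /LV/fsubsetP FV uv; apply/negP => /FV; rewrite mem_V.
  by case/orP: uv => /eqP->; rewrite /v; lia.
have m1 := pseudomanifold_perm P1 mL.
have sub1 := perm_mem P1.
have [|PL1 m2] := stacked_cone R d0 stB m1 (v := v).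
  by move=> F; rewrite -sub1 => FL; apply: vnew FL _; rewrite eqxx.
have vv : - v != v by rewrite /v; lia.
have P2 : perm_eq (cone_facets v (ball_boundary d B) ++ map oppface B ++ L0)
    (map oppface B ++ cone_facets v (ball_boundary d B) ++ L0).
  by rewrite perm_catCA.
have [|PL2 m3] := stacked_cone R d0 (stacked_oppface stB)
    (pseudomanifold_perm P2 m2) (v := - v).
  have old F : F \in B ++ (map oppface B ++ L0) -> - v \notin F.
    by rewrite -sub1 => FL; apply: vnew FL _; rewrite eqxx orbT.
  move=> F; rewrite mem_cat => /orP[FB|]; first by apply: old; rewrite !mem_cat FB orbT.
  rewrite mem_cat => /orP[/mapP[t /ball_boundary_sub[G GB tG] ->]|FL]; last first.
    by apply: old; rewrite !mem_cat FL !orbT.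
  rewrite !inE negb_or vv /=; apply: contra (fsubsetP tG (- v)) _.
  by apply: old; rewrite mem_cat GB.
have P3 : perm_eq
    (cone_facets (- v) (ball_boundary d (map oppface B)) ++
     cone_facets v (ball_boundary d B) ++ L0)
    (replace_facets d L B v).
  by rewrite /replace_facets -/L0 perm_catC -catA perm_catCA.
have mB := pseudomanifold_catl m1.
have mB' : pseudomanifold d (map oppface B).
  by apply: (@pseudomanifold_catl _ _ _ (B ++ L0)); apply: pseudomanifold_perm m1; rewrite perm_catCA.
have LO' : {in replace_facets d L B v, forall F, oppface F \in replace_facets d L B v}.
  move=> F; rewrite !mem_cat !mem_filter oppfaceK => /or3P[/andP[/andP[FB OB] FL]||].
  - by rewrite OB FB LO.
  - case/mapP=> t tB ->; apply/or3P/Or33/mapP; exists (oppface t).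
      by rewrite mem_ball_boundary_oppface oppfaceK.
    by rewrite oppfaceU oppface1.
  - case/mapP=> t tB ->; apply/or3P/Or32/mapP; exists (oppface t).
      by rewrite -mem_ball_boundary_oppface.
    by rewrite oppfaceU oppface1 opprK.
have Vn m : V m `<=` V m.+1 by apply/fsubsetP => x; rewrite !mem_V; lia.
have memL' F : F \in replace_facets d L B v -> F \in L \/
    exists u t, [/\ (u == v) || (u == - v), F = u |` t & exists2 G, G \in L & t `<=` G].
  rewrite !mem_cat mem_filter => /or3P[/andP[_ FL]||]; first by left.
    case/mapP=> t /ball_boundary_sub[G GB tG] ->; right; exists v, t.
    by rewrite eqxx; split=> //; exists G; rewrite ?BL.
  case/mapP=> t /ball_boundary_sub[G]; rewrite mem_map_oppface => GB tG ->.
  right; exists (- v), t; rewrite eqxx orbT; split=> //; exists G => //.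
  by rewrite -(oppfaceK G) LO // BL.
split=> //.
- exact: pseudomanifold_perm P3 m3.
- move=> F /memL'[/LV FV|[u [t [uv -> [G /LV GV tG]]]]].
    exact: fsubset_trans FV (Vn n).
  rewrite fsubUset fsub1set (fsubset_trans tG) ?(fsubset_trans GV) // andbT mem_V.
  by case/orP: uv => /eqP->; rewrite /v; lia.
- rewrite -(eq_generated (perm_mem P3)).
  apply: PL_homeomorphic_trans (PL_homeomorphic_sym PL2) _.
  rewrite -(eq_generated (perm_mem P2)).
  apply: PL_homeomorphic_trans (PL_homeomorphic_sym PL1) _.
  by rewrite -(eq_generated (perm_mem P1)).
have genO s : oppface s \in generated (replace_facets d L B v) ->
    s \in generated (replace_facets d L B v).
  case/in_generated=> F /LO' FL sF; apply/in_generated; exists (oppface F) => //.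
  by rewrite -oppface_subset oppfaceK.
have nbv s : s `<=` V n.+1 -> (#|` s| <= 2)%N -> antipode_free s -> v \in s ->
    s \in generated (replace_facets d L B v).
  move=> sV s2 /allP saf vs.
  have s'V x : x \in s `\ v -> x \in V n.
    rewrite in_fsetD1 => /andP[xv xs]; have := fsubsetP sV x xs; rewrite !mem_V.
    have := saf v vs => vs'; have : x != - v by apply: contraNneq vs' => <-.
    by rewrite /v in xv *; lia.
  have s'1 : (#|` s `\ v| <= 1)%N by have := cardfsD1 v s; rewrite vs; lia.
  have s'B : s `\ v \in generated B.
    case: (fset_0Vmem (s `\ v)) => [->|[x xs]].
      case: stB => [F|F ? ? _ _ _ _]; apply/in_generated; exists F;
      by rewrite ?mem_head ?fsub0set.
    have [F FB xF] := Bspan x (s'V x xs); apply/in_generated; exists F => //.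
    suff <- : [fset x] = s `\ v by rewrite fsub1set.
    by apply/eqP; rewrite eqEfcard fsub1set xs cardfs1.
  have /in_generated[t tB st] :=
    stacked_low_faces stB mB s'B (leq_ltn_trans s'1 (ltnW d2)).
  apply/in_generated; exists (v |` t).
    by rewrite !mem_cat; apply/or3P/Or32/map_f.
  by rewrite -fsubDset.
move=> s sV s2 saf; case: (boolP (v \in s)) => [|nvs]; first exact: nbv.
case: (boolP (- v \in s)) => [vs|nvs'].
  apply: genO; apply: nbv; rewrite ?card_oppface ?mem_oppface //.
    by apply/fsubsetP => x; rewrite mem_oppface => /(fsubsetP sV); rewrite !mem_V; lia.
  by apply/allP => x; rewrite !mem_oppface => /(allP saf).
have sVn : s `<=` V n.
  apply/fsubsetP => x xs; have := fsubsetP sV x xs; rewrite !mem_V.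
  have xv : x != v by apply: contraNneq nvs => <-.
  have xv' : x != - v by apply: contraNneq nvs' => <-.
  by rewrite /v in xv xv' *; lia.
have /in_generated[F] := nb s sVn s2 saf.
rewrite (perm_mem P1) !mem_cat => /or3P[FB|FB|FL] sF; last first.
- by apply/in_generated; exists F; rewrite // mem_cat FL.
- have /in_generated[t tB st] : s \in generated (ball_boundary d (map oppface B)).
    apply: stacked_low_faces; rewrite ?(leq_ltn_trans s2) //.
      exact: stacked_oppface.
    by apply/in_generated; exists F.
  apply/in_generated; exists (- v |` t); last by rewrite (fsubset_trans st) ?fsubsetU1.
  by rewrite !mem_cat; apply/or3P/Or33/map_f.
have /in_generated[t tB st] : s \in generated (ball_boundary d B).
  by apply: stacked_low_faces; rewrite ?(leq_ltn_trans s2) //; apply/in_generated; exists F.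
apply/in_generated; exists (v |` t); last by rewrite (fsubset_trans st) ?fsubsetU1.
by rewrite !mem_cat; apply/or3P/Or32/map_f.
Qed.

Lemma cs_sphere_vertices (R : realType) d n L :
  cs_sphere R d n L -> vertices (generated L) = V n.
Proof.
case=> _ LV _ _ nb; apply/fsetP => x; apply/bigfcupP/idP => [[s]|xV].
  by rewrite andbT => /in_generated[F /LV FV sF] /(fsubsetP sF)/(fsubsetP FV).
exists [fset x]; rewrite ?inE // andbT nb ?fsub1set ?cardfs1 //.
by apply/allP => y; rewrite !inE => /eqP->; move: xV; rewrite mem_V; lia.
Qed.

Lemma cs_sphere_centrally_symmetric (R : realType) d n L :
  cs_sphere R d n L -> centrally_symmetric (generated L).
Proof.
case=> _ _ LO _ _ s /in_generated[F /LO FL sF].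
by apply/in_generated; exists (oppface F); rewrite ?oppface_subset.
Qed.

End Antipodal.

(** * The cross-polytope *)

Section SimplexBoundary.
Variables (R : realType) (T : choiceType).

Lemma simplex_boundary_rename d (A : {fset T}) : #|` A| = d.+2 ->
  PL_homeomorphic R (simplex A `\ A) (simplex_boundary d).
Proof.
move=> Ad; have /fset0Pn[x0 _] : A != fset0 by rewrite -cardfs_gt0 Ad.
pose e (i : 'I_d.+2) := nth x0 (enum_fset A) i.
have e_inj : injective e.
  move=> i j /eqP; rewrite nth_uniq ?fset_uniq ?[size _]Ad ?ltn_ord //.
  by move/eqP/val_inj.
have eA i : e i \in A.
  by rewrite -[_ \in A]/(_ \in enum_fset A) mem_nth // [size _]Ad.
have Ae x : x \in A -> exists i, e i = x.
  move=> xA; have xlt : (index x (enum_fset A) < d.+2)%N by rewrite -Ad index_mem.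
  by exists (Ordinal xlt); rewrite /e /= nth_index.
suff -> : simplex A `\ A = [fset e @` (s : {fset 'I_d.+2}) | s in simplex_boundary d].
  exact: PL_homeomorphic_rename.
apply/fsetP => s; rewrite !in_fsetD1 fpowersetE; apply/andP/imfsetP => /=.
  case=> sA sAs; exists [fset i | i in 'I_d.+2 & e i \in s].
    rewrite in_fsetD1 fpowersetE; apply/andP; split.
      apply: contra sA => /eqP full; rewrite eqEfsubset sAs /=.
      apply/fsubsetP => x /Ae[i <-].
      by move/fsetP: full => /(_ i); rewrite !inE.
    by apply/fsubsetP => i; rewrite !inE.
  apply/fsetP => x; apply/idP/imfsetP => [xs|[i /=]]; last by rewrite !inE => ? ->.
  by have [i ei] := Ae x (fsubsetP sAs x xs); exists i; rewrite //= !inE ei.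
case=> t; rewrite in_fsetD1 => /andP[tn _] ->; split; last first.
  by apply/fsubsetP => _ /imfsetP[i _ ->].
apply: contra tn => /eqP tA; apply/eqP/fsetP => i; rewrite !inE.
by have := eA i; rewrite -tA mem_imfset.
Qed.

End SimplexBoundary.

Section CrossPolytope.
Implicit Types (s t F G : {fset int}) (x : int) (m : nat).

Lemma in_cross_boundary m s :
  (s \in cross_boundary m) = (s `<=` V m) && antipode_free s.
Proof. by rewrite !inE /= fpowersetE. Qed.

Definition cross_facets m : {fset {fset int}} :=
  [fset s in cross_boundary m | #|` s| == m].

Lemma in_cross_facets m s :
  (s \in cross_facets m) = [&& s `<=` V m, antipode_free s & #|` s| == m].
Proof. by rewrite in_fset /= inE /= in_cross_boundary andbA. Qed.

Let supp s := [fset `|x|%N | x in s].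

Let card_iota m : #|` [fset i in iota 1 m]| = m.
Proof. by rewrite card_fseq undup_id ?iota_uniq ?size_iota. Qed.

Let supp_sub m s : s `<=` V m -> supp s `<=` [fset i in iota 1 m].
Proof.
move/fsubsetP=> sV; apply/fsubsetP => _ /imfsetP[x /= /sV + ->].
by rewrite mem_V !inE mem_iota; lia.
Qed.

Let card_supp s : antipode_free s -> #|` supp s| = #|` s|.
Proof.
move=> /allP sa; apply: card_in_imfset => x y /= xs ys xy.
have : x = y \/ x = - y by lia.
by case=> // xE; have := sa y ys; rewrite -xE xs.
Qed.

Lemma card_cross_face_le m s : s \in cross_boundary m -> (#|` s| <= m)%N.
Proof.
rewrite in_cross_boundary => /andP[/supp_sub/fsubset_leq_card + sa].
by rewrite card_iota card_supp.
Qed.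

Lemma card_cross_face m s : s \in cross_boundary m ->
  #|` [fset i in iota 1 m | (i%:Z \notin s) && (- i%:Z \notin s)]| = (m - #|` s|)%N.
Proof.
rewrite in_cross_boundary => /andP[sV sa].
rewrite -[in RHS](card_iota m) -(card_supp sa) -cardfsDS ?supp_sub //.
congr #|` _|; apply/fsetP => i; rewrite !inE /= andbC; congr (_ && _).
rewrite -negb_or; congr negb; apply/orP/imfsetP => /= [|[x xs ->]].
  by case=> xs; [exists i%:Z|exists (- i%:Z)] => //; lia.
have [x0|x0] := lerP 0 x; [left|right].
  by have -> : (`|x|%N : int) = x by lia.
by have -> : - (`|x|%N : int) = x by lia.
Qed.

Lemma cross_extend m s : s \in cross_boundary m -> (#|` s| < m)%N ->
  exists2 x, x \notin s & x |` s \in cross_boundary m.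
Proof.
move=> sC sm; have : (0 < m - #|` s|)%N by rewrite subn_gt0.
rewrite -(card_cross_face sC) cardfs_gt0 => /fset0Pn[i].
rewrite !inE /= mem_iota => /andP[im /andP[is1 is2]].
move: sC; rewrite !in_cross_boundary => /andP[sV /allP sa].
exists i%:Z; rewrite // in_cross_boundary fsubUset fsub1set sV mem_V.
rewrite (_ : (_ < _ <= _)%N) /=; last by lia.
apply/allP => x; rewrite !inE negb_or => /orP[/eqP->|xs].
  by rewrite is2 andbT; lia.
rewrite (sa x xs) andbT; apply: contraNneq is2 => <-.
by rewrite opprK.
Qed.

Lemma generated_cross_facets m : generated (cross_facets m) = cross_boundary m.
Proof.
apply/fsetP => s; apply/in_generated/idP => [[F]|].
  rewrite in_cross_facets in_cross_boundary => /and3P[FV /allP Fa _] sF.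
  rewrite (fsubset_trans sF) //=; apply/allP => x xs.
  by apply: contra (Fa x (fsubsetP sF x xs)); apply/fsubsetP.
move: {-2}(m - _)%N (erefl (m - #|` s|)%N) => k.
elim: k s => [|k IH] s sk sC.
  exists s => //; rewrite in_cross_facets andbA -in_cross_boundary sC /=.
  by rewrite eqn_leq card_cross_face_le //= -subn_eq0 -sk.
have [|x xs xsC] := cross_extend sC.
  by rewrite -subn_gt0 -sk.
have [|//|F FL xsF] := IH (x |` s); first by rewrite cardfsU1 xs add1n subnS -sk.
by exists F => //; apply: fsubset_trans xsF; apply: fsubsetU1.
Qed.

Lemma cross_full m F x : F \in cross_facets m -> x \in V m ->
  (x \in F) || (- x \in F).
Proof.
rewrite in_cross_facets andbA -in_cross_boundary => /andP[FC /eqP Fm] xV.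
apply/norP => -[xF nxF]; have := card_cross_face FC; rewrite Fm subnn.
move/eqP; rewrite cardfs_eq0 => /eqP/fsetP/(_ `|x|%N).
rewrite !inE /= mem_iota => /negbT; rewrite negb_and.
move: xV; rewrite mem_V => xV.
have [x0|x0] := lerP 0 x.
  have -> : (`|x|%N : int) = x by lia.
  by rewrite xF nxF /= orbF; lia.
have -> : (`|x|%N : int) = - x by lia.
by rewrite opprK xF nxF /= orbF; lia.
Qed.

Lemma pseudomanifold_cross m : pseudomanifold m (cross_facets m.+1).
Proof.
split=> [|F|t tm]; first exact: fset_uniq.
  by rewrite -[_ \in _]/(F \in cross_facets _) in_cross_facets => /and3P[_ _ /eqP].
rewrite -size_filter; set S := [seq F <- _ | _].
have inS F : (F \in S) = (F \in cross_facets m.+1) && (t `<=` F).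
  by rewrite mem_filter andbC.
case ES: S => [//|F0 S']; rewrite -ES.
have : F0 \in S by rewrite ES mem_head.
rewrite inS => /andP[F0C tF0]; have := F0C; rewrite in_cross_facets.
case/and3P=> /fsubsetP F0V /allP F0a /eqP F0m.
have : (0 < #|` F0 `\` t|)%N by rewrite cardfsDS // F0m tm; lia.
rewrite cardfs_gt0 => /fset0Pn[a]; rewrite inE => /andP[ta aF0].
have tE : t = F0 `\ a.
  apply/eqP; rewrite eqEfcard fsubsetD1 tF0 ta tm /=.
  by have := cardfsD1 a F0; rewrite aF0 F0m => -[->].
suff : {subset S <= [:: F0; (- a) |` t]}.
  by move/uniq_leq_size; apply; rewrite filter_uniq ?fset_uniq.
move=> F; rewrite inS => /andP[FC tF]; have := FC; rewrite in_cross_facets.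
case/and3P=> FV Fa /eqP Fm; rewrite !inE.
case/orP: (cross_full FC (F0V a aF0)) => aF; apply/orP; [left|right].
  rewrite eq_sym eqEfcard Fm F0m leqnn andbT -(fsetD1K aF0) -tE.
  by rewrite fsubUset fsub1set aF.
rewrite eq_sym eqEfcard fsubUset fsub1set aF tF Fm cardfsU1 tm.
by rewrite tE in_fsetD1 (negPf (F0a a aF0)) andbF add1n ltnSn.
Qed.

Lemma cs_neighborly_cross i m : cs_neighborly i m (cross_boundary m).
Proof. by move=> s sV _ sa; rewrite in_cross_boundary sV. Qed.

Lemma oppface_cross m F : F \in cross_facets m -> oppface F \in cross_facets m.
Proof.
rewrite !in_cross_facets card_oppface => /and3P[/fsubsetP FV /allP Fa ->].
rewrite andbT; apply/andP; split.
  by apply/fsubsetP => x; rewrite mem_oppface => /FV; rewrite !mem_V; lia.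
by apply/allP => x; rewrite !mem_oppface => /Fa.
Qed.

End CrossPolytope.

Section CrossPolytopeSphere.
Implicit Types (s : {fset int}) (i j m : nat).

Let X j : {fset int} := 1 |` [fset - i%:Z | i in iota 1 j].

Let mem_X j x : (x \in X j) = (x == 1) || (- j%:Z <= x < 0).
Proof.
rewrite !inE; congr (_ || _); apply/imfsetP/idP => [[i /=]|xj].
  by rewrite mem_iota => ij ->; lia.
by exists `|x|%N; rewrite /= ?mem_iota; lia.
Qed.

(* Interpolates between the boundary of the simplex on [X m], for [j = m], and
   the boundary of the cross-polytope, for [j = 1]. *)
Let K m j : {fset {fset int}} :=
  [fset s in simplex (V m) |
    `[< [/\ forall i, (1 < i <= j)%N -> i%:Z \notin s, ~~ (X j `<=` s) &
            forall i, (j < i)%N -> i%:Z \in s -> - i%:Z \notin s] >]].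

Let inK m j s : reflect
  [/\ s `<=` V m, forall i, (1 < i <= j)%N -> i%:Z \notin s, ~~ (X j `<=` s) &
      forall i, (j < i)%N -> i%:Z \in s -> - i%:Z \notin s]
  (s \in K m j).
Proof.
rewrite !inE /= fpowersetE; apply: (iffP andP) => [[sV /asboolP[]]|[]] //.
by move=> ? ? ? ?; split=> //; apply/asboolP; split.
Qed.

Let X_sub j m : (0 < j <= m)%N -> X j `<=` V m.
Proof. by move=> jm; apply/fsubsetP => x; rewrite mem_X mem_V; lia. Qed.

Let XS j s : (X j.+1 `<=` s) = (X j `<=` s) && (- j.+1%:Z \in s).
Proof.
apply/idP/andP => [/fsubsetP Xs|[/fsubsetP Xs js]].
  split; last by apply: Xs; rewrite mem_X; lia.
  by apply/fsubsetP => x; rewrite mem_X => xX; apply: Xs; rewrite mem_X; lia.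
apply/fsubsetP => x; rewrite mem_X => xX.
case: (x =P - j.+1%:Z) => [->//|xj]; apply: Xs; rewrite mem_X; lia.
Qed.

Lemma cross_boundary_PL (R : realType) d :
  PL_homeomorphic R (cross_boundary d.+1) (simplex_boundary d).
Proof.
have K1 m : K m 1 = cross_boundary m.
  apply/fsetP => s; rewrite in_cross_boundary; apply/inK/andP => [[sV _ X1 sa]|].
    split=> //; apply/allP => x xs; have := fsubsetP sV x xs; rewrite mem_V => xm.
    apply: contra X1 => nxs; have [x1|x1] := eqVneq `|x|%N 1%N.
      have {}x1 : x = 1 \/ x = -1 by lia.
      apply/fsubsetP => y; rewrite mem_X => yX.
      by have [->|->] : y = x \/ y = - x by lia.
    have [i [i1 ix]] : exists i : nat, (1 < i)%N /\ (x = i%:Z \/ x = - i%:Z).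
      by exists `|x|%N; lia.
    have := sa i i1; case: ix xs nxs => ->; rewrite ?opprK => xs nxs.
      by rewrite xs nxs => /(_ isT).
    by rewrite xs nxs => /(_ isT).
  case=> sV /allP sa; split=> // [i||i _]; first by lia.
    apply/negP => /fsubsetP X1; have := sa 1 (X1 1 _); rewrite mem_X => /(_ isT).
    by rewrite X1 // mem_X.
  exact: sa.
have Km m : (0 < m)%N -> K m m = simplex (X m) `\ X m.
  move=> m0; apply/fsetP => s; rewrite in_fsetD1 fpowersetE.
  apply/inK/andP => [[/fsubsetP sV s1 sX _]|[sX Xs]].
    have sXs : s `<=` X m.
      apply/fsubsetP => x xs; have := sV x xs; rewrite mem_V mem_X => xm.
      have [x0|x0] := ltrP 0 x; last by lia.
      suff : ~~ (1 < `|x| <= m)%N by lia.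
      apply/negP => /s1; have -> : (`|x|%N : int) = x by lia.
      by rewrite xs.
    by split=> //; apply: contraNneq sX => ->.
  split.
  - by rewrite (fsubset_trans Xs) ?X_sub ?m0 /=.
  - by move=> i im; apply/negP => /(fsubsetP Xs); rewrite mem_X; lia.
  - by apply: contra sX => sX; rewrite eqEfsubset Xs.
  - by move=> i im /(fsubsetP Xs); rewrite mem_X; lia.
have step m j : (0 < j < m)%N -> PL_homeomorphic R (K m j) (K m j.+1).
  move=> jm; have X1 : 1 \in X j by rewrite mem_X.
  have nX (i : nat) : (1 < i)%N -> i%:Z \notin X j by rewrite mem_X; lia.
  have nX' (i : nat) : (j < i)%N -> - i%:Z \notin X j by rewrite mem_X; lia.
  apply: PL_homeomorphic_sym.
  apply: (@flip_PL_homeomorphic _ _ (X j) [fset j.+1%:Z]).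
  - by apply/fset0Pn; exists 1.
  - by apply/fset0Pn; exists j.+1%:Z; rewrite inE.
  - by rewrite fdisjointX1 nX //; lia.
  - apply/inK; split.
    + by apply: X_sub; lia.
    + by move=> i ij; apply: nX; lia.
    + by rewrite XS negb_and nX' ?orbT.
    + by move=> i ij /(negP (nX i _)) []; lia.
  - apply/inK; split.
    + by rewrite fsub1set mem_V; lia.
    + by move=> i ij; rewrite inE; lia.
    + by apply/negP => /fsubsetP/(_ 1 X1); rewrite inE; lia.
    + by move=> i ij; rewrite !inE; lia.
  - split=> s /inK[sV s1 sX sa].
    + move=> Xs a aX; have ja : - j.+1%:Z \notin s by move: sX; rewrite XS Xs.
      apply/inK; split.
      * rewrite fsubUset fsub1set mem_V (fsubset_trans (fsubsetDl _ _) sV) /=; lia.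
      * by move=> i ij; rewrite in_fsetU in_fsetD1 in_fset1 (negPf (s1 i _)); lia.
      * apply/negP => /fsubsetP/(_ a aX); rewrite in_fsetU in_fsetD1 in_fset1 eqxx /=.
        by move: aX; rewrite mem_X; lia.
      * move=> i ij; rewrite !in_fsetU !in_fsetD1 !in_fset1 => ia.
        rewrite negb_or negb_and; apply/andP; split; last by lia.
        case: (i =P j.+1) => [->|ij1]; first by rewrite ja orbT.
        by rewrite sa ?orbT //; move: ia; case: (i%:Z \in s) => //; lia.
    + move=> Xs; apply/inK; split=> // i ij; first by apply: s1; lia.
      case: (i =P j.+1) => [->|ij1]; last by apply: sa; lia.
      by rewrite (negPf (s1 j.+1 _)) //; lia.
    + by rewrite fsub1set; apply: s1; lia.
  - split=> s /inK[sV s1 sX sa] //.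
    + rewrite fsub1set => js _ /fset1P->.
      have ja : - j.+1%:Z \notin s by apply: sa.
      apply/inK; split.
      * by rewrite fsubUset (fsubset_trans (fsubsetDl _ _) sV) X_sub //=; lia.
      * move=> i ij; rewrite in_fsetU in_fsetD1 (negPf (nX i _)) ?orbF; last by lia.
        by case: (i =P j.+1) => [->|ij1]; rewrite ?eqxx // (negPf (s1 i _)) ?andbF //; lia.
      * by rewrite XS negb_and in_fsetU in_fsetD1 (negPf ja) (negPf (nX' _ _)) ?andbF ?orbT.
      * move=> i ij; rewrite in_fsetU in_fsetD1 (negPf (nX i _)) ?orbF; last by lia.
        case/andP=> _ /sa sai; rewrite in_fsetU in_fsetD1.
        by rewrite (negPf (nX' i _)) ?(negPf (sai _)) ?andbF //; lia.
    + rewrite fsub1set => js; apply/inK; split=> //.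
      * move=> i ij; case: (i =P j.+1) => [->//|ij1]; apply: s1; lia.
      * by rewrite XS negb_and sX.
      * by move=> i ij; apply: sa; lia.
have chain m j : (j < m)%N -> PL_homeomorphic R (K m 1) (K m j.+1).
  elim: j => [|j IH] jm; first exact: PL_homeomorphic_refl.
  by apply: PL_homeomorphic_trans (IH (ltnW jm)) (step _ _ _); lia.
rewrite -K1; apply: PL_homeomorphic_trans (chain d.+1 d (ltnSn d)) _.
rewrite Km //; apply: simplex_boundary_rename; rewrite /X cardfsU1.
have -> : #|` [fset - i%:Z | i in iota 1 d.+1]| = d.+1.
  have c : #|` [fset i in iota 1 d.+1]| = d.+1.
    by rewrite card_fseq undup_id ?iota_uniq ?size_iota.
  by rewrite -[RHS]c !card_imfset // => x y /oppr_inj[].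
suff -> : 1 \notin [fset - i%:Z | i in iota 1 d.+1] by [].
by apply/imfsetP => -[i /=]; lia.
Qed.

Lemma cs_sphere_cross (R : realType) d : cs_sphere R d d.+1 (cross_facets d.+1).
Proof.
split.
- exact: pseudomanifold_cross.
- by move=> F; rewrite -[_ \in _]/(F \in cross_facets _) in_cross_facets => /and3P[].
- exact: oppface_cross.
- by rewrite generated_cross_facets; apply: cross_boundary_PL.
- by rewrite generated_cross_facets; apply: cs_neighborly_cross.
Qed.

End CrossPolytopeSphere.

(** * The complexes Delta^3_n *)

Section DeltaThree.
Implicit Types (n m i j k : nat) (x : int) (F : {fset int}).

Lemma stacked_map (T : choiceType) (f : nat -> {fset T}) (N : nat) :
  (forall i, (i < N)%N -> exists2 w, w \in f i.+1 &
     (forall j, (j <= i)%N -> w \notin f j) /\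
     exists2 j, (j <= i)%N & f i.+1 `\ w `<=` f j) ->
  stacked [seq f i | i <- rev (iota 0 N.+1)].
Proof.
elim: N => [|N IH] fN; first exact: stacked_one.
have revS : rev (iota 0 N.+2) = N.+1 :: rev (iota 0 N.+1).
  by rewrite -(addn1 N.+1) iotaD rev_cat.
have [w wF [wf [j jN jF]]] := fN N (ltnSn N).
rewrite revS map_cons; apply: (@stacked_cons _ _ w) => //.
- by apply: IH => i iN; apply: fN; apply: leqW.
- by move=> _ /mapP[k + ->]; rewrite mem_rev mem_iota => /andP[_ kN]; apply: wf.
- exists (f j) => //; apply: map_f; rewrite mem_rev mem_iota.
  by rewrite add0n ltnS.
Qed.

Lemma mem_map_rev (T : eqType) (f : nat -> T) N y :
  reflect (exists2 i, (i < N)%N & y = f i) (y \in [seq f i | i <- rev (iota 0 N)]).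
Proof.
apply: (iffP mapP) => -[i]; first by rewrite mem_rev mem_iota => ? ->; exists i.
by move=> iN ->; exists i; rewrite // mem_rev mem_iota.
Qed.

Definition path_vertex m i : int :=
  if (i < m)%N then - i.+1%:Z else i%:Z - m%:Z + 1.

(* The ball [B^{3,1}_n]: the path (-1, ..., -(n - 2), 1, ..., n - 2) joined with
   the edge {n - 1, n}, and two further facets. *)
Definition B31_facet n i : {fset int} :=
  if (i < 2 * (n - 2) - 1)%N then
    [fset path_vertex (n - 2) i; path_vertex (n - 2) i.+1; n%:Z - 1; n%:Z]
  else if i == (2 * (n - 2) - 1)%N then [fset 1; 2 - n%:Z; 1 - n%:Z; n%:Z]
  else [fset 1; 2 - n%:Z; 1 - n%:Z; - n%:Z].

Definition B31_facets n : seq {fset int} :=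
  [seq B31_facet n i | i <- rev (iota 0 (2 * (n - 2)).+1)].

Lemma mem_B31_facet n i x : (1 < n)%N -> (x \in B31_facet n i) =
  if (i < 2 * (n - 2) - 1)%N then
    [|| (i < n - 2)%N && (x == - i.+1%:Z),
        (n - 2 <= i)%N && (x == i%:Z - n%:Z + 3),
        (i < n - 3)%N && (x == - i.+2%:Z),
        (n - 3 <= i)%N && (x == i%:Z - n%:Z + 4),
        x == n%:Z - 1 | x == n%:Z]
  else [|| x == 1, x == 2 - n%:Z, x == 1 - n%:Z |
    (i == (2 * (n - 2) - 1)%N) && (x == n%:Z) ||
    (i != (2 * (n - 2) - 1)%N) && (x == - n%:Z)].
Proof.
move=> n1; rewrite /B31_facet /path_vertex.
case: ifP => i1; last by case: ifP => i2; rewrite !inE; lia.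
by rewrite !inE; do ?[case: ifP => ?]; lia.
Qed.

Lemma card_B31_facet n i : (3 < n)%N -> #|` B31_facet n i| = 4.
Proof.
have card4 (a b c e : int) : uniq [:: a; b; c; e] -> #|` [fset a; b; c; e]| = 4.
  move=> u; have -> : [fset a; b; c; e] = [fset x in [:: a; b; c; e]].
    by apply/fsetP => x; rewrite !inE; do 4!case: (x == _).
  by rewrite card_fseq undup_id.
move=> n3; rewrite /B31_facet /path_vertex.
case: ifP => i1; last by case: ifP => i2; rewrite card4 //= !inE; lia.
by rewrite card4 //= !inE; do ?[case: ifP => ?]; lia.
Qed.

Lemma stacked_B31 n : (3 < n)%N -> stacked (B31_facets n).
Proof.
move=> n3; apply: stacked_map => i iN.
pose w : int := if (i.+1 < 2 * (n - 2) - 1)%N then path_vertex (n - 2) i.+2 else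
  if (i.+1 == 2 * (n - 2) - 1)%N then 1 - n%:Z else - n%:Z.
pose j := if (i.+1 == 2 * (n - 2) - 1)%N then (n - 3)%N else i.
exists w; last split.
- rewrite mem_B31_facet ?(ltnW (ltnW n3)) // /w /path_vertex.
  by do ?[case: ifP => ?]; lia.
- move=> k ki; rewrite mem_B31_facet ?(ltnW (ltnW n3)) // /w /path_vertex.
  by do ?[case: ifP => ?]; lia.
exists j; first by rewrite /j; case: ifP => ?; lia.
apply/fsubsetP => x; rewrite in_fsetD1 !mem_B31_facet ?(ltnW (ltnW n3)) //.
rewrite /w /j /path_vertex; case: (i.+1 =P _) => i1;
  by do ?[case: ifP => ?]; lia.
Qed.

Lemma B31_span n x : (3 < n)%N -> x \in V n ->
  exists2 F, F \in B31_facets n & x \in F.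
Proof.
move=> n3; rewrite mem_V => xn.
suff [i iN xi] : exists2 i, (i < (2 * (n - 2)).+1)%N & x \in B31_facet n i.
  by exists (B31_facet n i) => //; apply/mem_map_rev; exists i.
have E i := mem_B31_facet i x (ltnW (ltnW n3)).
case: (x =P - n%:Z) => xN; first by exists (2 * (n - 2))%N; rewrite ?E; try case: ifP; lia.
case: (x =P 1 - n%:Z) => xN1; first by exists (2 * (n - 2))%N; rewrite ?E; try case: ifP; lia.
have [x1|x1] := lerP (n%:Z - 1) x; first by exists 0%N; rewrite ?E; try case: ifP; lia.
have [x0|x0] := ltrP 0 x.
  by exists (`|x|%N + n - 4)%N; rewrite ?E; try case: ifP; lia.
by exists (`|x|%N - 2)%N; rewrite ?E; try case: ifP; lia.
Qed.

Lemma B31_antipodal n F : (3 < n)%N ->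
  F \in B31_facets n -> oppface F \notin B31_facets n.
Proof.
move=> n3 /mem_map_rev[i iN ->]; apply/mem_map_rev => -[j jN].
have E k x := mem_B31_facet k x (ltnW (ltnW n3)).
move/fsetP => H; have {}H x : (- x \in B31_facet n i) = (x \in B31_facet n j).
  by rewrite -H mem_oppface.
have hN k : (n%:Z \in B31_facet n k) || (- n%:Z \in B31_facet n k).
  by rewrite !E; case: ifP; lia.
have hT k : - n%:Z \in B31_facet n k -> 1 \in B31_facet n k.
  by rewrite !E; case: ifP; lia.
have h1 k : -1 \in B31_facet n k -> n%:Z - 2 \notin B31_facet n k.
  by rewrite !E; case: ifP; lia.
have hT2 k : - n%:Z \in B31_facet n k -> 2 - n%:Z \in B31_facet n k.
  by rewrite !E; case: ifP; lia.
case/orP: (hN i) => iT.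
  have jT : - n%:Z \in B31_facet n j by rewrite -H opprK.
  have : n%:Z - 2 \notin B31_facet n i by apply: h1; rewrite H hT.
  by rewrite -opprB H hT2.
have : n%:Z - 2 \notin B31_facet n j by apply: h1; rewrite -H opprK hT.
by rewrite -H opprB hT2.
Qed.

Lemma B31_faces n F : (3 < n)%N -> F \in B31_facets n ->
  F `<=` V n /\ antipode_free F.
Proof.
move=> n3 /mem_map_rev[i iN ->]; have E k x := mem_B31_facet k x (ltnW (ltnW n3)).
split; first by apply/fsubsetP => x; rewrite E mem_V; case: ifP; lia.
by apply/allP => x; rewrite !E; case: ifP; lia.
Qed.

Let cycle_vertex m i : int := if (i < m)%N then i.+1%:Z else m%:Z - i.+1%:Z.

Let cycle_verticesE m :
  [seq i%:Z | i <- iota 1 m] ++ [seq - i%:Z | i <- iota 1 m] =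
  [seq cycle_vertex m i | i <- iota 0 (m + m)].
Proof.
rewrite iotaD map_cat; congr (_ ++ _).
  rewrite -[1%N]/(1 + 0)%N iotaDl -map_comp; apply/eq_in_map => i.
  by rewrite mem_iota /cycle_vertex /= => ->.
have -> : iota (0 + m) m = [seq (m + i)%N | i <- iota 0 m] by rewrite -iotaDl addn0.
rewrite -[1%N]/(1 + 0)%N iotaDl -!map_comp.
by apply/eq_in_map => i _; rewrite /cycle_vertex /=; case: ifP; lia.
Qed.

Definition cycle_edge m i : {fset int} :=
  [fset cycle_vertex m i; if (i.+1 < m + m)%N then cycle_vertex m i.+1 else 1].

Lemma next_map_iota (T : eqType) (f : nat -> T) k i :
  {in iota 0 k.+1 &, injective f} -> (i < k.+1)%N ->
  next [seq f j | j <- iota 0 k.+1] (f i) = f (if (i < k)%N then i.+1 else 0%N).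
Proof.
move=> f_inj ik; have iI : i \in iota 0 k.+1 by rewrite mem_iota.
rewrite next_nth (map_f f iI).
have -> : index (f i) [seq f j | j <- iota 0 k.+1] = i.
  have {1}-> : f i = nth (f i) [seq f j | j <- iota 0 k.+1] i.
    by rewrite (nth_map 0%N) ?size_iota // nth_iota.
  by rewrite index_uniq ?size_map ?size_iota // map_inj_in_uniq ?iota_uniq.
rewrite /=; case: ifP => ik'; last by rewrite nth_default // size_map size_iota; lia.
by rewrite (nth_map 0%N) ?size_iota // nth_iota.
Qed.

Let Delta1E m : (0 < m)%N ->
  Delta 1 m = generated [seq cycle_edge m i | i <- iota 0 (m + m)].
Proof.
move=> m0; rewrite /Delta /= /cycle_complex cycle_verticesE -map_comp.
have inj : {in iota 0 (m + m) &, injective (cycle_vertex m)}.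
  by move=> j k _ _; rewrite /cycle_vertex; do 2!case: ifP; lia.
congr generated; apply/eq_in_map => i; rewrite mem_iota add0n => /andP[_ im].
rewrite /cycle_edge /=; congr [fset _; _].
move: inj im; case: (m + m)%N (erefl (m + m)%N) => // k mk inj im.
rewrite next_map_iota // ltnS; case: ifP => // _.
by rewrite /cycle_vertex m0.
Qed.

Definition path_edge m i : {fset int} := [fset path_vertex m i; path_vertex m i.+1].

Let path_edgesE m : (1 < m)%N ->
  cdiff (Delta 1 m) (simplex [fset -1; m%:Z]) =
  generated [seq path_edge m i | i <- iota 0 (2 * m - 1)].
Proof.
move=> m1; rewrite Delta1E; last by lia.
have card2 : {in [seq cycle_edge m i | i <- iota 0 (m + m)], forall F, #|` F| = 2}.
  move=> _ /mapP[i _ ->]; rewrite /cycle_edge cardfs2 /cycle_vertex.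
  by do ?[case: ifP => ?]; lia.
have in_filter (Y : {fset {fset int}}) (P : pred {fset int}) F :
  (F \in [fset s in Y | P s]) = (F \in Y) && P F by rewrite !inE.
apply: eq_generated => F.
rewrite in_filter (facets_generated card2) fpowersetE.
apply/andP/mapP => [[/mapP[i]]|[i]]; rewrite mem_iota add0n => /andP[_ im] ->.
  rewrite fsubUset !fsub1set !inE /cycle_vertex => ne.
  exists (if (i < m)%N then i + m else i - m)%N; first by move: ne; rewrite mem_iota; do ?[case: ifP => ?]; lia.
  apply/fsetP => x; rewrite !inE /cycle_vertex /path_vertex; move: ne.
  by do ?[case: ifP => ?]; lia.
split; last first.
  by rewrite fsubUset !fsub1set !inE /path_vertex; do ?[case: ifP => ?]; lia.
apply/mapP; exists (if (i < m)%N then i + m else i - m)%N.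
  by rewrite mem_iota; case: ifP; lia.
apply/fsetP => x; rewrite !inE /cycle_vertex /path_vertex.
by do ?[case: ifP => ?]; lia.
Qed.

Lemma cone0 (T : choiceType) (v : T) : cone fset0 v = fset0.
Proof. by apply/fsetP => s; apply/imfset2P => -[]. Qed.

Lemma simplexE (T : choiceType) (A : {fset T}) : simplex A = generated [:: A].
Proof. by rewrite /generated big_seq1. Qed.

Lemma B31_generated n : (3 < n)%N -> (DeltaB 3).2 1 n = generated (B31_facets n).
Proof.
move=> n3.
have -> : (DeltaB 3).2 1 n =
    cone (cone (cdiff (Delta 1 n.-2) (simplex [fset -1; n.-2%:Z])) n.-1%:Z `|`
          cone (oppcomplex (simplex [fset -1; n.-2%:Z])) (- n.-1%:Z)) n%:Z `|`
    cone (oppcomplex (cone (simplex [fset -1; n.-2%:Z]) n.-1%:Z `|`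
          cone (oppcomplex fset0) (- n.-1%:Z))) (- n%:Z) by [].
rewrite path_edgesE; last by lia.
rewrite oppcomplex0 cone0 fsetU0 simplexE !oppcomplex_generated !cone_generated.
rewrite !oppcomplex_generated -generated_cat !cone_generated -generated_cat.
apply: eq_generated => F; rewrite mem_cat.
have mV (s : {fset int}) x : (x \in oppface s) = (- x \in s) by apply: mem_oppface.
have N1 : n.-1%:Z = n%:Z - 1 by lia.
have N2 : (n - 2)%N%:Z = n%:Z - 2 by lia.
have -> : (n.-2 = n - 2)%N by lia.
apply/orP/mem_map_rev.
  case=> /mapP[G]; last first.
    rewrite inE => /eqP-> ->; exists (2 * (n - 2))%N => //.
    apply/fsetP => x; rewrite mem_B31_facet ?(ltnW (ltnW n3)) // !(inE, mV) N1 N2.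
    by case: ifP; lia.
  rewrite mem_cat => /orP[/mapP[_ /mapP[i + ->] ->]|]; last first.
    rewrite inE => /eqP-> ->; exists (2 * (n - 2) - 1)%N; first by lia.
    apply/fsetP => x; rewrite mem_B31_facet ?(ltnW (ltnW n3)) // !(inE, mV) N1 N2.
    by case: ifP; lia.
  rewrite mem_iota add0n => /andP[_ im] ->; exists i; first by lia.
  apply/fsetP => x; rewrite /B31_facet im !inE N1.
  by do 4!case: (x == _).
case=> i im ->; case: (ltnP i (2 * (n - 2) - 1)) => im1.
  left; apply/mapP; exists ((n.-1%:Z) |` path_edge (n - 2) i).
    rewrite mem_cat map_f //; apply: (map_f (path_edge (n - 2))).
    by rewrite mem_iota.
  apply/fsetP => x; rewrite /B31_facet im1 !inE N1.
  by do 4!case: (x == _).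
case: (i =P (2 * (n - 2) - 1)%N) => i1; [left|right]; apply/mapP.
  exists (- n.-1%:Z |` oppface [fset -1; (n - 2)%N%:Z]).
    by rewrite mem_cat mem_seq1 eqxx orbT.
  apply/fsetP => x; rewrite mem_B31_facet ?(ltnW (ltnW n3)) // !(inE, mV) N1 N2.
  by case: ifP; lia.
exists (oppface (n.-1%:Z |` [fset -1; (n - 2)%N%:Z])).
  by rewrite mem_seq1 eqxx.
apply/fsetP => x; rewrite mem_B31_facet ?(ltnW (ltnW n3)) // !(inE, mV) N1 N2.
by case: ifP; lia.
Qed.

Fixpoint Delta3_facets k : seq {fset int} :=
  if k is k'.+1 then
    replace_facets 3 (Delta3_facets k') (B31_facets (4 + k')) (5 + k')%:Z
  else cross_facets 4.

Lemma mem_replace_boundary d L B v t : t \in ball_boundary d B ->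
  v |` t \in replace_facets d L B v.
Proof. by move=> tB; rewrite !mem_cat; apply/or3P/Or32/map_f. Qed.

Lemma mem_replace_boundary_opp d L B v t : oppface t \in ball_boundary d B ->
  - v |` t \in replace_facets d L B v.
Proof.
by rewrite -mem_ball_boundary_oppface !mem_cat => tB; apply/or3P/Or33/map_f.
Qed.

Lemma mem_replace_keep d L B v F : F \in L -> F \notin B -> oppface F \notin B ->
  F \in replace_facets d L B v.
Proof. by move=> FL FB OB; rewrite !mem_cat mem_filter FB OB FL. Qed.

Lemma B31_boundary n i (a b c : int) : (3 < n)%N -> (i < (2 * (n - 2)).+1)%N ->
  uniq [:: a; b; c] ->
  [&& a \in B31_facet n i, b \in B31_facet n i & c \in B31_facet n i] ->
  (forall j, (j < (2 * (n - 2)).+1)%N ->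
     [&& a \in B31_facet n j, b \in B31_facet n j & c \in B31_facet n j] -> j = i) ->
  a |` (b |` [fset c]) \in ball_boundary 3 (B31_facets n).
Proof.
move=> n3 im u abc uniq_i; apply: (@ball_boundaryP _ _ _ (B31_facet n i)).
- exact/stacked_uniq/stacked_B31.
- by apply/mem_map_rev; exists i.
- by rewrite !fsubUset !fsub1set.
- by move: u; rewrite /= !cardfsU1 cardfs1 !inE => /and3P[-> ->].
move=> _ /mem_map_rev[j jm ->]; rewrite !fsubUset !fsub1set => abcj.
by rewrite (uniq_i j).
Qed.

Lemma B31_step n L : (3 < n)%N ->
  {subset B31_facets n.+1 <= replace_facets 3 L (B31_facets n) n.+1%:Z}.
Proof.
move=> n3 _ /mem_map_rev[i im ->].
have E k x := mem_B31_facet k x (ltnW (ltnW n3)).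
have E' k x := mem_B31_facet k x (leqW (ltnW (ltnW n3))).
have bd j a b c := @B31_boundary n j a b c n3.
case: (ltnP i (2 * (n - 1) - 1)) => i1; last first.
  case: (i =P (2 * (n - 1) - 1)%N) => i2.
    have -> : B31_facet n.+1 i = n.+1%:Z |` (1 |` ((1 - n%:Z) |` [fset - n%:Z])).
      by apply/fsetP => x; rewrite E' !inE; case: ifP; lia.
    apply: mem_replace_boundary; apply: (bd (2 * (n - 2))%N); rewrite ?E //=.
    - by rewrite !inE; lia.
    - by case: ifP; lia.
    - by move=> j jm; rewrite !E; case: ifP; lia.
  have -> : B31_facet n.+1 i = - n.+1%:Z |` (1 |` ((1 - n%:Z) |` [fset - n%:Z])).
    by apply/fsetP => x; rewrite E' !inE; case: ifP; lia.
  apply: mem_replace_boundary_opp.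
  have -> : oppface (1 |` ((1 - n%:Z) |` [fset - n%:Z])) =
      -1 |` ((n%:Z - 1) |` [fset n%:Z]).
    by apply/fsetP => x; rewrite mem_oppface !inE; lia.
  apply: (bd 0%N); rewrite ?E //=.
  - by rewrite !inE; lia.
  - by case: ifP; lia.
  - by move=> j jm; rewrite !E; case: ifP; lia.
pose a := path_vertex (n - 1) i; pose b := path_vertex (n - 1) i.+1.
have -> : B31_facet n.+1 i = n.+1%:Z |` (a |` (b |` [fset n%:Z])).
  rewrite /B31_facet (_ : n.+1 - 2 = n - 1)%N ?i1; last by lia.
  have -> : n.+1%:Z - 1 = n%:Z by lia.
  by apply/fsetP => x; rewrite !inE; do 4!case: (x == _).
apply: mem_replace_boundary.
pose j := if (i < n - 3)%N then i else if (i < n - 1)%N then (2 * (n - 2) - 1)%N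
  else if i == (2 * (n - 2))%N then (2 * (n - 2) - 2)%N else (i - 1)%N.
have ab : uniq [:: a; b; n%:Z].
  by rewrite /= !inE /a /b /path_vertex; do ?[case: ifP => ?]; lia.
apply: (bd j) => // [|| k km]; rewrite ?E /j /a /b /path_vertex {ab E E' bd}.
- by do ?[case: ifP => ?]; lia.
- by case: (ltnP i (n - 3)) => ?; last (case: (ltnP i (n - 1)) => ?;
    last case: (i =P (2 * (n - 2))%N) => ?); do ?[case: ifP => ?]; lia.
- by case: (ltnP i (n - 3)) => ?; last (case: (ltnP i (n - 1)) => ?;
    last case: (i =P (2 * (n - 2))%N) => ?); do ?[case: ifP => ?]; lia.
Qed.

End DeltaThree.

Section DeltaThreeSphere.
Implicit Types (n m i j k l : nat) (x : int) (F : {fset int}).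

Lemma cs_stacked_B31 n L : (3 < n)%N -> {subset B31_facets n <= L} ->
  cs_stacked n L (B31_facets n).
Proof.
move=> n3 BL; split=> //; first exact: stacked_B31.
  by move=> F; apply: B31_antipodal.
by move=> x; apply: B31_span.
Qed.

Lemma Delta3_facetsP (R : realType) k :
  cs_sphere R 3 (4 + k) (Delta3_facets k) /\
  {subset B31_facets (4 + k) <= Delta3_facets k}.
Proof.
elim: k => [|k [IH BL]].
  split=> [|F FB]; first exact: cs_sphere_cross.
  rewrite -[_ \in _]/(F \in cross_facets 4) in_cross_facets.
  have [FV ->] := B31_faces (isT : (3 < 4)%N) FB; rewrite FV /=.
  by have /mem_map_rev[i _ ->] := FB; rewrite card_B31_facet.
split; last by rewrite addnS; apply: B31_step.
by rewrite addnS; apply: cs_sphere_replace => //; apply: cs_stacked_B31.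
Qed.

Lemma Delta3_generated (R : realType) k :
  Delta 3 (4 + k) = generated (Delta3_facets k).
Proof.
have -> : Delta 3 (4 + k) = iter_replace 3 ((DeltaB 3).2 1) (4 + k - 4) by [].
rewrite addKn; elim: k => [|k IH] /=; first by rewrite generated_cross_facets.
have [[[_ card _] _ _ _ _] _] := Delta3_facetsP R k.
have B4 : {in B31_facets (4 + k), forall F, #|` F| = 4}.
  by move=> _ /mem_map_rev[i _ ->]; apply: card_B31_facet.
rewrite -replace_generated -?IH -?B31_generated //.
exact/stacked_uniq/stacked_B31.
Qed.

(* These facets of [Delta^3_(n+1)] are in no later ball, hence in all the later
   complexes. *)
Definition path_facet n i : {fset int} :=
  [fset path_vertex (n - 2) i; path_vertex (n - 2) i.+1; n%:Z - 1; n%:Z + 1].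

Lemma mem_path_facet k i l : (i < 2 * (k + 2) - 1)%N -> (k < l)%N ->
  path_facet (4 + k) i \in Delta3_facets l.
Proof.
set n := (4 + k)%N => ik; have n3 : (3 < n)%N by [].
have k2 : (k + 2 = n - 2)%N by rewrite /n; lia.
rewrite k2 in ik.
have E j x := mem_B31_facet j x (ltnW (ltnW n3)).
elim: l => // l IH; rewrite ltnS leq_eqVlt => /predU1P[<-|kl].
  rewrite -[Delta3_facets _]/(replace_facets 3 (Delta3_facets k) _ _).
  set a := path_vertex (n - 2) i; set b := path_vertex (n - 2) i.+1.
  have -> : path_facet n i = (5 + k)%:Z |` (a |` (b |` [fset n%:Z - 1])).
    have -> : (5 + k)%:Z = n%:Z + 1 by lia.
    by apply/fsetP => x; rewrite !inE; do 4!case: (x == _).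
  apply: mem_replace_boundary; apply: (B31_boundary (i := i)) => //.
  - by rewrite ltnS; lia.
  - by rewrite /= !inE /a /b /path_vertex; do ?[case: ifP => ?]; lia.
  - by rewrite /B31_facet ik !inE !eqxx ?orbT.
  - move=> j jm; rewrite !E /a /b /path_vertex {E IH}.
    by do ?[case: ifP => ?]; lia.
have Fabs x : x \in path_facet n i -> (`|x| <= n.-2)%N || (x == n%:Z - 1) || (x == n%:Z + 1).
  rewrite !inE /path_vertex; do ?[case: ifP => ?]; lia.
have Babs G : G \in B31_facets (4 + l) ->
    (exists2 x, x \in G & `|x|%N = (4 + l)%N) /\
    (exists2 x, x \in G & `|x|%N = (3 + l)%N).
  case/mem_map_rev=> j jm ->.
  have E' x := mem_B31_facet (n := 4 + l) j x isT.
  split; case: (ltnP j (2 * (4 + l - 2) - 1)) => jl.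
  - by exists (4 + l)%:Z; rewrite ?E'; try case: ifP; lia.
  - case: (j =P (2 * (4 + l - 2) - 1)%N) => jl'.
      by exists (4 + l)%:Z; rewrite ?E'; try case: ifP; lia.
    by exists (- (4 + l)%:Z); rewrite ?E'; try case: ifP; lia.
  - by exists (3 + l)%:Z; rewrite ?E'; try case: ifP; lia.
  - by exists (- (3 + l)%:Z); rewrite ?E'; try case: ifP; lia.
have old G : G \in B31_facets (4 + l) ->
    ~ (forall x, x \in G -> exists2 y, y \in path_facet n i & `|x|%N = `|y|%N).
  case/Babs=> -[x xG xl] [y yG yl] sub.
  have [x' /Fabs x'F xx'] := sub x xG; have [y' /Fabs y'F yy'] := sub y yG.
  by move: x'F y'F; rewrite /n; lia.
apply: mem_replace_keep; first exact: IH.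
  by apply/negP => /old; apply => x xF; exists x.
apply/negP => /old; apply => x; rewrite mem_oppface => xF; exists (- x) => //; lia.
Qed.

End DeltaThreeSphere.

(** * The balls B(I) *)

Section BallBI.
Variables (n : nat) (I : seq nat).
Hypotheses (hn : (10 <= n)%N) (hI : index_family n I).
Implicit Types (m i j k u : nat) (x : int) (F : {fset int}).

(* The largest element of [I] below [m], or 0 if there is none. *)
Fixpoint last_below m : nat :=
  if m is m'.+1 then if m' \in I then m' else last_below m' else 0%N.

Lemma index_bounds u : u \in I -> (3 <= u <= n - 6)%N.
Proof. by case: hI => _ /allP + _; apply. Qed.

Lemma last_belowP m :
  (last_below m = 0%N /\ forall u, u \in I -> (m <= u)%N) \/
  [/\ last_below m \in I, (last_below m < m)%N &
      forall u, u \in I -> (u < m)%N -> (u <= last_below m)%N].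
Proof.
elim: m => [|m IH]; first by left.
rewrite /=; case: ifP => mI; first by right; split=> // u _; rewrite ltnS.
case: IH => [[c0 Im]|[cI cm Im]]; [left|right].
  split=> // u uI; rewrite ltn_neqAle Im // andbT.
  by apply: contraFneq mI => ->.
split=> //; first exact: leqW.
move=> u uI; rewrite ltnS leq_eqVlt => /predU1P[um|]; last exact: Im.
by rewrite um mI in uI.
Qed.

(* The facets of [BI] in an order making it a stacked ball; those of index
   [i >= n] are the ones of vertex [- n + m + 1] with [m = i + 2 - n]. *)
Definition BI_facet i : {fset int} :=
  if (i == 0)%N then [fset 1; 2; n%:Z - 1; n%:Z]
  else if (i < n - 3)%N then [fset 1; 2; n%:Z - i%:Z - 1; n%:Z - i%:Z + 1]
  else if (i == n - 3)%N then [fset 1; - n%:Z + 2; n%:Z - 1; n%:Z]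
  else if (i == n - 2)%N then [fset 1; - n%:Z + 2; - n%:Z + 1; n%:Z]
  else if (i == n - 1)%N then [fset 1; - n%:Z + 2; - n%:Z + 1; - n%:Z]
  else
    let m := (i + 2 - n)%N in let c := last_below m in
    [fset - n%:Z + m%:Z + 1; if m.-1 \in I then 1 else - n%:Z + m%:Z;
          n%:Z - c%:Z - 1; if c == 0%N then n%:Z else n%:Z - c%:Z + 1].

Definition BI_stack : seq {fset int} :=
  [seq BI_facet i | i <- rev (iota 0 (2 * n - 4).+1)].

Variant BI_facet_spec i : {fset int} -> Prop :=
| BI_facet_first of i = 0%N : BI_facet_spec i [fset 1; 2; n%:Z - 1; n%:Z]
| BI_facet_positive of (0 < i < n - 3)%N :
    BI_facet_spec i [fset 1; 2; n%:Z - i%:Z - 1; n%:Z - i%:Z + 1]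
| BI_facet_turn1 of i = (n - 3)%N :
    BI_facet_spec i [fset 1; - n%:Z + 2; n%:Z - 1; n%:Z]
| BI_facet_turn2 of i = (n - 2)%N :
    BI_facet_spec i [fset 1; - n%:Z + 2; - n%:Z + 1; n%:Z]
| BI_facet_turn3 of i = (n - 1)%N :
    BI_facet_spec i [fset 1; - n%:Z + 2; - n%:Z + 1; - n%:Z]
| BI_facet_jump m of i = (m + n - 2)%N & (4 <= m <= n - 5)%N & m.-1 \in I
    & last_below m = m.-1 :
    BI_facet_spec i [fset - n%:Z + m%:Z + 1; 1; n%:Z - m%:Z; n%:Z - m%:Z + 2]
| BI_facet_low m of i = (m + n - 2)%N & (2 <= m <= n - 2)%N & m.-1 \notin I
    & last_below m = 0%N :
    BI_facet_spec i [fset - n%:Z + m%:Z + 1; - n%:Z + m%:Z; n%:Z - 1; n%:Z]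
| BI_facet_high m c of i = (m + n - 2)%N & (5 <= m <= n - 2)%N & m.-1 \notin I
    & last_below m = c & c \in I & (3 <= c <= n - 6)%N & (c.+1 < m)%N :
    BI_facet_spec i [fset - n%:Z + m%:Z + 1; - n%:Z + m%:Z;
                          n%:Z - c%:Z - 1; n%:Z - c%:Z + 1].

Lemma BI_facetP i : (i <= 2 * n - 4)%N -> BI_facet_spec i (BI_facet i).
Proof.
move=> im; rewrite /BI_facet.
case: (i =P 0%N) => [i0|i0]; first exact: BI_facet_first.
case: (ltnP i (n - 3)) => i1; first by apply: BI_facet_positive; lia.
case: (i =P (n - 3)%N) => i2; first exact: BI_facet_turn1.
case: (i =P (n - 2)%N) => i3; first exact: BI_facet_turn2.
case: (i =P (n - 1)%N) => i4; first exact: BI_facet_turn3.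
set m := (i + 2 - n)%N; have iE : i = (m + n - 2)%N by rewrite /m; lia.
have m2 : (2 <= m <= n - 2)%N by rewrite /m; lia.
clearbody m => /=; case: ifP => mI.
  have mB := index_bounds mI.
  have cE : last_below m = m.-1 by case: m mI m2 {iE mB} => [|m] //= ->.
  rewrite cE ifF; last by lia.
  have -> : n%:Z - (m.-1)%:Z - 1 = n%:Z - m%:Z by lia.
  have -> : n%:Z - (m.-1)%:Z + 1 = n%:Z - m%:Z + 2 by lia.
  by apply: BI_facet_jump => //; lia.
case: (last_belowP m) => [[c0 _]|[cI cm cmax]].
  by rewrite c0 /= subr0; apply: BI_facet_low; rewrite // mI.
have cB := index_bounds cI; rewrite ifF; last by lia.
have cm1 : last_below m <> m.-1 by move=> cE; rewrite cE mI in cI.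
by apply: BI_facet_high; rewrite ?mI //; lia.
Qed.

Lemma stacked_BI : stacked BI_stack.
Proof.
apply: stacked_map => i iN.
have lb m : (0 < m)%N -> m.-1 \notin I -> last_below m = last_below m.-1.
  by case: m => //= m _ /negPf->.
have new w : (forall j, (j <= i)%N -> (j <= 2 * n - 4)%N -> w \notin BI_facet j) ->
    forall j, (j <= i)%N -> w \notin BI_facet j.
  by move=> wi j ji; apply: wi => //; lia.
have sub w F j : (j <= 2 * n - 4)%N -> (forall x, (x != w) && (x \in F) ==> (x \in BI_facet j)) ->
    F `\ w `<=` BI_facet j.
  by move=> jN FB; apply/fsubsetP => x; rewrite in_fsetD1; apply/implyP.
case: BI_facetP => // [iE|iE|iE|iE|m iE mB mI cE|m iE mB mI cE|m c iE mB mI cE cI cB cm].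
- exists (n%:Z - i.+1%:Z - 1); first by rewrite !inE eqxx ?orbT.
  split; first by apply: new => j ji jN; case: BI_facetP => // *; rewrite !inE; lia.
  exists (i - 1)%N; first by lia.
  apply: sub; first by lia.
  by move=> x; case: BI_facetP => *; rewrite ?inE; lia.
- exists (- n%:Z + 2); first by rewrite !inE eqxx ?orbT.
  split; first by apply: new => j ji jN; case: BI_facetP => // *; rewrite !inE; lia.
  exists 0%N => //; apply: sub; first by lia.
  by move=> x; case: BI_facetP => *; rewrite ?inE; lia.
- exists (- n%:Z + 1); first by rewrite !inE eqxx ?orbT.
  split; first by apply: new => j ji jN; case: BI_facetP => // *; rewrite !inE; lia.
  exists (n - 3)%N; first by lia.
  apply: sub; first by lia.
  by move=> x; case: BI_facetP => *; rewrite ?inE; lia.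
- exists (- n%:Z); first by rewrite !inE eqxx ?orbT.
  split; first by apply: new => j ji jN; case: BI_facetP => // *; rewrite !inE; lia.
  exists (n - 2)%N; first by lia.
  apply: sub; first by lia.
  by move=> x; case: BI_facetP => *; rewrite ?inE; lia.
- exists (- n%:Z + m%:Z + 1); first by rewrite !inE eqxx ?orbT.
  split; first by apply: new => j ji jN; case: BI_facetP => // *; rewrite !inE; lia.
  exists (m - 1)%N; first by lia.
  apply: sub; first by lia.
  by move=> x; case: BI_facetP => *; rewrite ?inE; lia.
- exists (- n%:Z + m%:Z + 1); first by rewrite !inE eqxx ?orbT.
  split; first by apply: new => j ji jN; case: BI_facetP => // *; rewrite !inE; lia.
  have iN' : (i <= 2 * n - 4)%N by lia.
  have cE' : last_below m.-1 = 0%N by rewrite -lb //; lia.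
  exists (if m == 2%N then n - 3 else i)%N; first by case: eqP; lia.
  apply: sub; first by case: eqP; lia.
  move=> x; case: (m =P 2%N) => /= m2; first by case: BI_facetP => *; rewrite ?inE; lia.
  case: (BI_facetP iN') => [iE_|iE_|iE_|iE_|iE_|m' iE' mB' _ cE''|m' iE' mB' _ cE''
    |m' c iE' mB' _ cE'' _ cB _]; rewrite ?inE; try lia;
  have m'E : m' = m.-1 by lia.
  + by rewrite m'E cE' in cE''; lia.
  + by rewrite m'E cE' in cE''; lia.
- exists (- n%:Z + m%:Z + 1); first by rewrite !inE eqxx ?orbT.
  split; first by apply: new => j ji jN; case: BI_facetP => // *; rewrite !inE; lia.
  have iN' : (i <= 2 * n - 4)%N by lia.
  have cE' : last_below m.-1 = c by rewrite -lb //; lia.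
  exists i => //; apply: sub; first by lia.
  move=> x; case: (BI_facetP iN') => [iE_|iE_|iE_|iE_|iE_|m' iE' mB' _ cE''
    |m' iE' mB' _ cE''|m' c' iE' mB' _ cE'' _ cB' _]; rewrite ?inE; try lia;
  have m'E : m' = m.-1 by lia.
  + by rewrite m'E cE' in cE''; lia.
  + by rewrite m'E cE' in cE''; lia.
  + by rewrite m'E cE' in cE''; lia.
Qed.

Lemma BI_span x : x \in V n -> exists2 F, F \in BI_stack & x \in F.
Proof.
rewrite mem_V => xn.
suff [i iN xi] : exists2 i, (i <= 2 * n - 4)%N & x \in BI_facet i.
  by exists (BI_facet i) => //; apply/mem_map_rev; exists i.
have [x1|x1] := lerP (- n%:Z + 3) x; last first.
  exists (n - 1)%N; first by lia.
  by case: BI_facetP => *; rewrite ?inE; lia.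
have [x0|x0] := ltrP 0 x; last first.
  exists (2 * n - 3 - `|x|)%N; first by lia.
  by case: BI_facetP => *; rewrite ?inE; lia.
have [x2|x2] := lerP x 2.
  by exists 0%N => //; case: BI_facetP => *; rewrite ?inE; lia.
have [x3|x3] := lerP x (n%:Z - 2); last first.
  by exists 0%N => //; case: BI_facetP => *; rewrite ?inE; lia.
exists (n - 1 - `|x|)%N; first by lia.
by case: BI_facetP => *; rewrite ?inE; lia.
Qed.

Lemma BI_antipodal F : F \in BI_stack -> oppface F \notin BI_stack.
Proof.
case/mem_map_rev=> i iN ->; apply/mem_map_rev => -[j jN].
have anti1 k : (k <= 2 * n - 4)%N ->
    (-1 \in BI_facet k) ==> (-2 \in BI_facet k).
  by move=> kN; case: BI_facetP => // *; rewrite !inE; lia.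
have pos k x : (k <= 2 * n - 4)%N ->
    [&& 1 \in BI_facet k, 2 \in BI_facet k & x \in BI_facet k] ==> (0 < x).
  by move=> kN; case: BI_facetP => // *; rewrite !inE; lia.
have expos k : (k <= 2 * n - 4)%N -> exists2 x, x \in BI_facet k & 0 < x.
  move=> kN; case: BI_facetP => // [_|_|_|_|_|m _ _ _ _|m _ _ _ _|m c _ _ _ _ _ cB _];
  try (by exists 1; rewrite ?inE; lia); try (by exists (n%:Z - 1); rewrite ?inE; lia).
  by exists (n%:Z - c%:Z - 1); rewrite ?inE; lia.
have consec k : (k <= 2 * n - 4)%N -> 1 \in BI_facet k \/
    exists a : nat, [&& (0 < a < n - 2)%N, - a%:Z \in BI_facet k & - a.+1%:Z \in BI_facet k].
  move=> kN; case: BI_facetP => // [_|_|_|_|_|m _ _ _ _|m _ mB _ _|m c _ mB _ _ _ _ _];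
  try (by left; rewrite !inE; lia); right.
    by exists (n - m - 1)%N; rewrite !inE; lia.
  by exists (n - m - 1)%N; rewrite !inE; lia.
have nconsec k a : (k <= 2 * n - 4)%N -> (0 < a < n - 2)%N ->
    [&& 1 \notin BI_facet k, a%:Z \in BI_facet k & a.+1%:Z \in BI_facet k] = false.
  by move=> kN aB; case: BI_facetP => // *; rewrite !inE; lia.
have no1 k l : (k <= 2 * n - 4)%N -> (l <= 2 * n - 4)%N ->
    BI_facet l = oppface (BI_facet k) -> 1 \notin BI_facet k.
  move=> kN lN E; apply/negP => k1.
  have l1 : -1 \in BI_facet l by rewrite E mem_oppface opprK.
  have k2 : 2 \in BI_facet k.
    by have /implyP := anti1 l lN; rewrite l1 E mem_oppface opprK => ->.
  have [x] := expos l lN; rewrite E mem_oppface => xk.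
  by have /implyP := pos k (- x) kN; rewrite k1 k2 xk => /(_ isT); lia.
move=> E; have i1 := no1 i j iN jN (esym E).
have j1 : 1 \notin BI_facet j by apply: (no1 j i); rewrite // -E oppfaceK.
have [|[a /and3P[aB ai ai']]] := consec i iN; first exact/negP.
by have := nconsec j a jN aB; rewrite j1 -E !mem_oppface ai ai'.
Qed.

End BallBI.

Section BallInDelta.
Variables (n : nat) (I : seq nat).
Hypotheses (hn : (10 <= n)%N) (hI : index_family n I).
Implicit Types (m i j k u : nat) (x : int) (F : {fset int}).

Lemma BI_stack_sub (R : realType) :
  {subset BI_stack n I <= Delta3_facets (n - 4)}.
Proof.
have [_ BL] := Delta3_facetsP R (n - 4); rewrite subnKC in BL; last by lia.
have old i F : (i < (2 * (n - 2)).+1)%N -> B31_facet n i = F -> F \in Delta3_facets (n - 4).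
  by move=> im <-; apply: BL; apply/mem_map_rev; exists i.
have mid k i F : (4 <= k < n)%N -> (i < 2 * (k - 2) - 1)%N -> path_facet k i = F ->
    F \in Delta3_facets (n - 4).
  move=> kn ik <-; have -> : k = (4 + (k - 4))%N by lia.
  by apply: mem_path_facet; lia.
have n1 : (1 < n)%N by lia.
move=> _ /mem_map_rev[i iN ->].
case: BI_facetP => // [_|iB|_|_|_|m _ mB _ _|m _ mB _ _|m c _ mB _ _ _ cB cm].
- apply: (old (n - 2)%N); first by lia.
  by apply/fsetP => x; rewrite mem_B31_facet // !inE; case: ifP; lia.
- apply: (mid (n - i)%N (n - i - 2)%N); try lia.
  by apply/fsetP => x; rewrite !inE /path_vertex; do ?[case: ifP => ?]; lia.
- apply: (old (n - 3)%N); first by lia.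
  by apply/fsetP => x; rewrite mem_B31_facet // !inE; case: ifP; lia.
- apply: (old (2 * (n - 2) - 1)%N); first by lia.
  by apply/fsetP => x; rewrite mem_B31_facet // !inE; case: ifP; lia.
- apply: (old (2 * (n - 2))%N); first by lia.
  by apply/fsetP => x; rewrite mem_B31_facet // !inE; case: ifP; lia.
- apply: (mid (n - m + 1)%N (n - m - 2)%N); try lia.
  by apply/fsetP => x; rewrite !inE /path_vertex; do ?[case: ifP => ?]; lia.
- apply: (old (n - m - 2)%N); first by lia.
  by apply/fsetP => x; rewrite mem_B31_facet // !inE; case: ifP; lia.
- apply: (mid (n - c)%N (n - m - 2)%N); try lia.
  by apply/fsetP => x; rewrite !inE /path_vertex; do ?[case: ifP => ?]; lia.
Qed.

Let idx j := nth (n - 2)%N I j.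

Let idx_lt j k : (j < k < size I)%N -> (idx j < idx k)%N.
Proof.
case: hI => sI _ _ /andP[jk kI].
by apply: (sorted_ltn_nth ltn_trans) => //; rewrite inE ?(ltn_trans jk).
Qed.

Let idx_in j : (j < size I)%N -> idx j \in I.
Proof. exact: mem_nth. Qed.

Let idx_le_in u : u \in I -> (idx 0 <= u)%N.
Proof.
move=> uI; have uS : (index u I < size I)%N by rewrite index_mem.
have <- : idx (index u I) = u by rewrite /idx nth_index.
case: (posnP (index u I)) => [->//|u0]; apply: ltnW.
by apply: idx_lt; rewrite u0.
Qed.

Let last_below_low m : (m <= idx 0)%N -> last_below I m = 0%N.
Proof.
move=> m0; case: (last_belowP I m) => [[]//|[cI cm _]].
by have := idx_le_in cI; lia.
Qed.

Let last_below_high j m : (j < size I)%N -> (idx j < m <= idx j.+1)%N ->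
  last_below I m = idx j.
Proof.
move=> jI jm; case: (last_belowP I m) => [[_ /(_ _ (idx_in jI))]|]; first by lia.
case=> cI cm /(_ _ (idx_in jI)) cj; have {}cj := cj _.
have kS : (index (last_below I m) I < size I)%N by rewrite index_mem.
have kE : idx (index (last_below I m) I) = last_below I m by rewrite /idx nth_index.
case: (ltngtP (index (last_below I m) I) j) => jk; last by rewrite -kE jk.
  by have := @idx_lt (index (last_below I m) I) j; rewrite jk jI kE => /(_ isT); lia.
suff : (idx j.+1 <= last_below I m)%N by lia.
rewrite -kE; move: jk; rewrite leq_eqVlt => /predU1P[->//|jk].
by apply/ltnW/idx_lt; rewrite jk.
Qed.

Let idx_le_max j : (idx j <= n - 2)%N.
Proof.
case: (ltnP j (size I)) => jI; last by rewrite /idx nth_default.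
by have := index_bounds hI (idx_in jI); lia.
Qed.

Lemma BI_generated : BI n I = generated (BI_stack n I).
Proof.
apply: eq_generated => F; apply/idP/idP; last first.
  case/mem_map_rev=> i iN ->; rewrite !mem_cat.
  case: BI_facetP => // [_|iB|_|_|_|m _ mB mI cE|m _ mB mI cE|m c _ mB mI cE cI cB cm].
  - by apply/orP; right; rewrite !inE eqxx.
  - apply/orP; left; apply/mapP; exists (n - 1 - i)%N; first by rewrite mem_index_iota; lia.
    by apply/fsetP => x; rewrite !inE; lia.
  - by apply/orP; right; rewrite !inE eqxx ?orbT.
  - by apply/orP; right; rewrite !inE eqxx ?orbT.
  - by apply/orP; right; rewrite !inE eqxx ?orbT.
  - apply/or4P/Or44/flatten_mapP; exists (index m.-1 I).
      by rewrite mem_iota add0n index_mem.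
    rewrite nth_index // inE; apply/orP; left; apply/eqP.
    by apply/fsetP => x; rewrite !inE; lia.
  - apply/or4P/Or43/mapP; exists m; last first.
      by apply/fsetP => x; rewrite !inE; lia.
    rewrite mem_index_iota ltnS; apply/andP; split; first by lia.
    rewrite leqNgt; apply/negP => m0.
    have I0 : (0 < size I)%N.
      by rewrite lt0n size_eq0; apply: contraTneq m0 => ->; rewrite /= -leqNgt; lia.
    case: (last_belowP I m) => [[_ /(_ _ (idx_in I0))]|[cI _ _]]; first by rewrite /idx; lia.
    by have := index_bounds hI cI; rewrite cE.
  - apply/or4P/Or44/flatten_mapP; exists (index c I).
      by rewrite mem_iota add0n index_mem.
    rewrite nth_index // inE; apply/orP; right; apply/mapP; exists m; last first.
      by apply/fsetP => x; rewrite !inE; lia.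
    rewrite mem_index_iota ltnS; apply/andP; split; first by lia.
    rewrite leqNgt; apply/negP => m1; have cS : (index c I < size I)%N by rewrite index_mem.
    case: (ltnP (index c I).+1 (size I)) => c1; last by rewrite nth_default // in m1; lia.
    case: (last_belowP I m) => [[c0 _]|[_ _ /(_ _ (idx_in c1) m1)]]; first by lia.
    have := @idx_lt (index c I) (index c I).+1; rewrite ltnSn c1 => /(_ isT).
    by rewrite {1}/idx nth_index // cE; lia.
have at_ i G : (i <= 2 * n - 4)%N -> BI_facet n I i = G -> G \in BI_stack n I.
  by move=> iN <-; apply/mem_map_rev; exists i.
rewrite !mem_cat => /or4P[/mapP[i + ->]|FE|/mapP[m + ->]|/flatten_mapP[j]].
- rewrite mem_index_iota => iB.
  apply: (at_ (n - 1 - i)%N); first by lia.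
  by apply/fsetP => x; case: BI_facetP => // *; rewrite ?inE; lia.
- move: FE; rewrite !inE => /or4P[]/eqP->.
  + apply: (at_ 0%N); first by lia.
    by apply/fsetP => x; case: BI_facetP => // *; rewrite ?inE; lia.
  + apply: (at_ (n - 3)%N); first by lia.
    by apply/fsetP => x; case: BI_facetP => // *; rewrite ?inE; lia.
  + apply: (at_ (n - 2)%N); first by lia.
    by apply/fsetP => x; case: BI_facetP => // *; rewrite ?inE; lia.
  + apply: (at_ (n - 1)%N); first by lia.
    by apply/fsetP => x; case: BI_facetP => // *; rewrite ?inE; lia.
- rewrite mem_index_iota ltnS -/(idx 0) => mB; have i0n := idx_le_max 0.
  have mI : m.-1 \notin I by apply/negP => /idx_le_in; lia.
  have c0 : last_below I m = 0%N by apply: last_below_low; case/andP: mB.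
  apply: (at_ (m + n - 2)%N); first by lia.
  apply/fsetP => x; case: BI_facetP => // [|iE|iE|iE|iE|iE|m' iE _ mI' _|m' iE _ _ _|m' c iE _ _ cE _ cB _];
    first (by lia); rewrite ?inE; try lia; have mE : m' = m by lia.
  + by rewrite mE (negPf mI) in mI'.
  + by rewrite mE c0 in cE; lia.
rewrite mem_iota add0n => /andP[_ jI]; have jin := idx_in jI.
have jB := index_bounds hI jin; rewrite inE => /orP[/eqP->|/mapP[m + ->]].
  apply: (at_ (idx j + n - 1)%N); first by lia.
  apply/fsetP => x; rewrite -/(idx j).
  case: BI_facetP => // [|iE|iE|iE|iE|iE|m' iE _ _ _|m' iE _ mI' _|m' c iE _ mI' cE _ cB _];
    first (by lia); rewrite ?inE; try lia; have mE : m'.-1 = idx j by lia.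
  + by rewrite mE jin in mI'.
  + by rewrite mE jin in mI'.
rewrite mem_index_iota ltnS => mB; rewrite -/(idx j) in mB *.
rewrite -/(idx j.+1) in mB; have j1 := idx_le_max j.+1.
have cE : last_below I m = idx j by apply: last_below_high; rewrite //; lia.
have mI : m.-1 \notin I.
  apply/negP => mI; case: (last_belowP I m) => [[_ /(_ _ mI)]|[_ _ /(_ _ mI)]]; first by lia.
  by rewrite cE; lia.
apply: (at_ (m + n - 2)%N); first by lia.
apply/fsetP => x.
case: BI_facetP => // [|iE|iE|iE|iE|iE|m' iE _ mI' _|m' iE _ _ c0|m' c iE _ _ cE' _ cB _];
  first (by lia); rewrite ?inE; try lia; have mE : m' = m by lia.
- by rewrite mE (negPf mI) in mI'.
- by rewrite mE cE in c0; lia.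
- by rewrite mE cE in cE'; rewrite -cE' mE; lia.
Qed.

End BallInDelta.

Theorem theorem7p6 (R : realType) (n : nat) (I : seq nat)
    (hn : (10 <= n)%N) (hI : index_family n I) :
  [/\ centrally_symmetric (DeltaI n I),
      combinatorial_sphere R 3 (DeltaI n I),
      vertices (DeltaI n I) = V n.+1 &
      cs_neighborly 2 n.+1 (DeltaI n I)].
Proof.
have n4 : (4 + (n - 4) = n)%N by rewrite subnKC //; lia.
have [] := Delta3_facetsP R (n - 4); rewrite n4 => sph _.
have stk : cs_stacked n (Delta3_facets (n - 4)) (BI_stack n I).
  split; [exact: stacked_BI|exact: (BI_stack_sub hn hI R)|..].
    by move=> F; apply: BI_antipodal.
  by move=> x; apply: BI_span.
have sphI := cs_sphere_replace (isT : (2 < 3)%N) sph stk.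
have [[_ card _] _ _ _ _] := sph.
have -> : DeltaI n I =
    generated (replace_facets 3 (Delta3_facets (n - 4)) (BI_stack n I) n.+1%:Z).
  rewrite /DeltaI BI_generated // -replace_generated //.
  - by rewrite -(Delta3_generated R) n4.
  - by move=> F /(cs_stacked_sub stk)/card.
  - exact/stacked_uniq/(cs_stacked_ball stk).
split.
- exact: cs_sphere_centrally_symmetric sphI.
- by split; [exact: is_complex_generated|exact: cs_PL sphI].
- exact: cs_sphere_vertices sphI.
- exact: cs_neighborly2 sphI.
Qed.
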